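(* Let $G$ be a finite group. As a $\widetilde{\mathrm{Rep}(G)}$-module category, $\mathcal{Z}(\mathrm{Rep}(G))$ decomposes into indecomposable module subcategories indexed by the conjugacy classes of $G$.
   Context: Conventions: $k$ is a fixed field (typically of characteristic $0$); all categories are abelian, finite and $k$-linear. A fusion category is a semisimple finite $k$-linear rigid monoidal category with $\mathrm{End}(1)\simeq k$ and finitely many simple objects. $\mathrm{Rep}(G)$ is the symmetric fusion category of finite-dimensional representations of $G$ over $k$ and $\mathcal{Z}(\mathrm{Rep}(G))$ is its Drinfeld center. For a braided fusion category $\mathcal{C}$ with braiding $c$ and centralizer $\mathcal{C}'$ (the full subcategory of objects $X$ with $c_{Y,X}c_{X,Y}=\mathrm{id}$ for all $Y$), put $\widetilde{\mathcal{C}}:=\mathcal{C}\boxtimes_{\mathcal{C}'}\mathcal{C}^{rev}$, where $\mathcal{C}^{rev}$ is $\mathcal{C}$ with opposite tensor product and $\boxtimes_{\mathcal{C}'}$ is the relative tensor product (the abelian category universal for right exact $\mathcal{C}'$-balanced functors out of $\mathcal{C}\boxtimes\mathcal{C}^{rev}$). $\widetilde{\mathcal{C}}$ is identified with the braided fusion subcategory of $\mathcal{Z}(\mathcal{C})$ which is the smallest tensor subcategory containing all objects $(X,c_{-,X})$ and $(X,c^{-1}_{X,-})$, $X\in\mathcal{C}$ (half-braidings written $Y\otimes X\to X\otimes Y$); $\mathcal{Z}(\mathcal{C})$ is a $\widetilde{\mathcal{C}}$-module category via its tensor product. For $\mathcal{C}=\mathrm{Rep}(G)$ one has $\mathcal{C}'=\mathcal{C}$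 and $\widetilde{\mathrm{Rep}(G)}\simeq\mathrm{Rep}(G)$ as fusion categories. *)

(* Defs.v *)
From HB Require Import structures.
From mathcomp Require Import all_boot all_order all_algebra all_fingroup.
From mathcomp Require Import all_character.
From mathcomp Require Import boolp.

Set Implicit Arguments.
Unset Strict Implicit.
Unset Printing Implicit Defensive.

Import GRing.Theory.
Local Open Scope ring_scope.

Section Subspace.
Variables (k : fieldType) (V : lmodType k).

Record subspace := Subspace {
  subspace_pred : V -> Prop;
  subspace0 : subspace_pred 0;
  subspaceP : forall a u v,
    subspace_pred u -> subspace_pred v -> subspace_pred (a *: u + v) }.

Variable S : subspace.

Definition subspace_mem : {pred V} := fun v => `[< subspace_pred S v >].

Fact subspace_mem_closed : submod_closed subspace_mem.
Proof.
split=> [|a u v /asboolP Su /asboolP Sv]; apply/asboolP.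
  exact: subspace0.
exact: subspaceP.
Qed.

HB.instance Definition _ :=
  GRing.isSubmodClosed.Build k V subspace_mem subspace_mem_closed.

Record subspace_type :=
  SubspaceElt { subspace_val :> V; _ : subspace_val \in subspace_mem }.

HB.instance Definition _ := [isSub for subspace_val].
HB.instance Definition _ := [Choice of subspace_type by <:].
HB.instance Definition _ := [SubChoice_isSubLmodule of subspace_type by <:].

Definition subspace_elt v (Sv : subspace_pred S v) : subspace_type :=
  SubspaceElt (asboolT Sv).

Lemma subspace_valP (v : subspace_type) : subspace_pred S v.
Proof. by case: v => v /= /asboolP. Qed.

Lemma subspace_valL a (u v : subspace_type) :
  subspace_val (a *: u + v) = a *: subspace_val u + subspace_val v.
Proof. by []. Qed.

End Subspace.

(* Composition is written in diagrammatic order: f ;; g is "f, then g". *)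
Record lincat (k : fieldType) := Lincat {
  Ob :> Type;
  Hom : Ob -> Ob -> lmodType k;
  idm : forall X, Hom X X;
  comp : forall X Y Z, Hom X Y -> Hom Y Z -> Hom X Z;
  comp1m : forall X Y (f : Hom X Y), comp (idm X) f = f;
  compm1 : forall X Y (f : Hom X Y), comp f (idm Y) = f;
  compA : forall X Y Z T (f : Hom X Y) (g : Hom Y Z) (h : Hom Z T),
    comp (comp f g) h = comp f (comp g h);
  comp_linl : forall X Y Z (g : Hom Y Z), linear (fun f : Hom X Y => comp f g);
  comp_linr : forall X Y Z (f : Hom X Y), linear (fun g : Hom Y Z => comp f g) }.

Arguments Hom {k l} X Y.
Arguments idm {k l} X.
Arguments comp {k l X Y Z} f g.

Declare Scope cat_scope.
Delimit Scope cat_scope with cat.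
Local Open Scope cat_scope.
Notation "f ;; g" := (comp f g) (at level 55, right associativity) : cat_scope.

Section LincatNotions.
Variables (k : fieldType) (C : lincat k).

Definition inverses (X Y : C) (f : Hom X Y) (g : Hom Y X) : Prop :=
  f ;; g = idm X /\ g ;; f = idm Y.

Definition is_iso (X Y : C) (f : Hom X Y) : Prop := exists g, inverses f g.

Definition is_mono (X Y : C) (f : Hom X Y) : Prop :=
  forall Z (g h : Hom Z X), g ;; f = h ;; f -> g = h.

Definition is_epi (X Y : C) (f : Hom X Y) : Prop :=
  forall Z (g h : Hom Y Z), f ;; g = f ;; h -> g = h.

Definition is_zero (X : C) : Prop := idm X = 0.

Definition is_direct_sum (I : finType) (X : I -> C) (S : C) : Prop :=
  exists (i : forall j, Hom (X j) S) (p : forall j, Hom S (X j)),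
    [/\ forall j, i j ;; p j = idm (X j),
        forall j l, j != l -> i j ;; p l = 0 &
        \sum_j (p j ;; i j) = idm S].

(* The case of the empty index type gives the zero objects.                   *)
Record subquotient_closed (P : C -> Prop) : Prop := SubquotientClosed {
  sq_sum : forall (I : finType) (X : I -> C) S,
    is_direct_sum X S -> (forall j, P (X j)) -> P S;
  sq_sub : forall X Y (f : Hom X Y), is_mono f -> P Y -> P X;
  sq_quot : forall X Y (f : Hom X Y), is_epi f -> P X -> P Y }.

Definition full_sub (P : C -> Prop) : lincat k :=
  @Lincat k {X : C | P X} (fun X Y => Hom (sval X) (sval Y))
    (fun X => idm (sval X)) (fun X Y Z f g => f ;; g)
    (fun X Y => @comp1m k C (sval X) (sval Y))
    (fun X Y => @compm1 k C (sval X) (sval Y))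
    (fun X Y Z T => @compA k C (sval X) (sval Y) (sval Z) (sval T))
    (fun X Y Z => @comp_linl k C (sval X) (sval Y) (sval Z))
    (fun X Y Z => @comp_linr k C (sval X) (sval Y) (sval Z)).

End LincatNotions.

Record moncat (k : fieldType) := Moncat {
  mon_cat :> lincat k;
  one : mon_cat;
  tens : mon_cat -> mon_cat -> mon_cat;
  tensm : forall X Y X' Y',
    Hom X X' -> Hom Y Y' -> Hom (tens X Y) (tens X' Y');
  tensm1 : forall X Y, tensm (idm X) (idm Y) = idm (tens X Y);
  tensmM : forall X X' X'' Y Y' Y'' (f : Hom X X') (f' : Hom X' X'')
      (g : Hom Y Y') (g' : Hom Y' Y''),
    tensm (f ;; f') (g ;; g') = tensm f g ;; tensm f' g';
  tensm_linl : forall X Y X' Y' (g : Hom Y Y'),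
    linear (fun f : Hom X X' => tensm f g);
  tensm_linr : forall X Y X' Y' (f : Hom X X'),
    linear (fun g : Hom Y Y' => tensm f g);
  asso : forall X Y Z, Hom (tens (tens X Y) Z) (tens X (tens Y Z));
  assoV : forall X Y Z, Hom (tens X (tens Y Z)) (tens (tens X Y) Z);
  assoK : forall X Y Z, inverses (asso X Y Z) (assoV X Y Z);
  asso_nat : forall X Y Z X' Y' Z' (f : Hom X X') (g : Hom Y Y') (h : Hom Z Z'),
    tensm (tensm f g) h ;; asso X' Y' Z' = asso X Y Z ;; tensm f (tensm g h);
  lun : forall X, Hom (tens one X) X;
  lunV : forall X, Hom X (tens one X);
  lunK : forall X, inverses (lun X) (lunV X);
  lun_nat : forall X Y (f : Hom X Y), tensm (idm one) f ;; lun Y = lun X ;; f;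
  run : forall X, Hom (tens X one) X;
  runV : forall X, Hom X (tens X one);
  runK : forall X, inverses (run X) (runV X);
  run_nat : forall X Y (f : Hom X Y), tensm f (idm one) ;; run Y = run X ;; f;
  pentagon : forall X Y Z T,
    tensm (asso X Y Z) (idm T) ;; asso X (tens Y Z) T ;;
      tensm (idm X) (asso Y Z T)
    = asso (tens X Y) Z T ;; asso X Y (tens Z T);
  triangle : forall X Y,
    asso X one Y ;; tensm (idm X) (lun Y) = tensm (run X) (idm Y) }.

Arguments one {k m}.
Arguments tens {k m} X Y.
Arguments tensm {k m X Y X' Y'} f g.
Arguments asso {k m} X Y Z.
Arguments assoV {k m} X Y Z.
Arguments lun {k m} X.
Arguments lunV {k m} X.
Arguments run {k m} X.
Arguments runV {k m} X.

Notation "X ⊗ Y" := (tens X Y) (at level 40, left associativity) : cat_scope.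
Notation "f ⊗₁ g" := (tensm f g) (at level 40, left associativity) : cat_scope.
Notation "𝟙" := one : cat_scope.

Section MoncatTheory.
Variables (k : fieldType) (C : moncat k).
Implicit Types X Y Z T : C.

Lemma assoKl X Y Z : asso X Y Z ;; assoV X Y Z = idm _.
Proof. by case: (assoK X Y Z). Qed.
Lemma assoKr X Y Z : assoV X Y Z ;; asso X Y Z = idm _.
Proof. by case: (assoK X Y Z). Qed.
Lemma lunKl X : lun X ;; lunV X = idm _. Proof. by case: (lunK X). Qed.
Lemma lunKr X : lunV X ;; lun X = idm _. Proof. by case: (lunK X). Qed.
Lemma runKl X : run X ;; runV X = idm _. Proof. by case: (runK X). Qed.
Lemma runKr X : runV X ;; run X = idm _. Proof. by case: (runK X). Qed.

Lemma comp_rw X Y Z T (f : Hom X Y) (g : Hom Y Z) h (u : Hom Z T) :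
  f ;; g = h -> f ;; (g ;; u) = h ;; u.
Proof. by move<-; rewrite compA. Qed.

Lemma monoiso X Y Z (f g : Hom X Y) (u : Hom Y Z) (v : Hom Z Y) :
  u ;; v = idm _ -> f ;; u = g ;; u -> f = g.
Proof. by move=> uv e; rewrite -[f]compm1 -[g]compm1 -uv -!compA e. Qed.

Lemma epiiso X Y Z (f g : Hom Y Z) (u : Hom X Y) (v : Hom Y X) :
  v ;; u = idm _ -> u ;; f = u ;; g -> f = g.
Proof. by move=> vu e; rewrite -[f]comp1m -[g]comp1m -vu !compA e. Qed.

Lemma mover X Y Z (f : Hom X Y) (g : Hom X Z) (u : Hom Y Z) (v : Hom Z Y) :
  inverses u v -> f ;; u = g -> f = g ;; v.
Proof. by case=> uv _ <-; rewrite compA uv compm1. Qed.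

Lemma movel X Y Z (f : Hom Y Z) (g : Hom X Z) (u : Hom X Y) (v : Hom Y X) :
  inverses u v -> u ;; f = g -> f = v ;; g.
Proof. by case=> _ vu <-; rewrite -compA vu comp1m. Qed.

Lemma assoV_nat X Y Z X' Y' Z' (f : Hom X X') (g : Hom Y Y') (h : Hom Z Z') :
  f ⊗₁ (g ⊗₁ h) ;; assoV X' Y' Z' = assoV X Y Z ;; (f ⊗₁ g) ⊗₁ h.
Proof.
by apply/esym/(mover (assoK _ _ _)); rewrite compA asso_nat -compA assoKr comp1m.
Qed.

Lemma tmMr X Y Y' Y'' (g : Hom Y Y') (g' : Hom Y' Y'') :
  idm X ⊗₁ (g ;; g') = idm X ⊗₁ g ;; idm X ⊗₁ g'.
Proof. by rewrite -tensmM comp1m. Qed.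

Lemma tmMl X Y Y' Y'' (g : Hom Y Y') (g' : Hom Y' Y'') :
  (g ;; g') ⊗₁ idm X = g ⊗₁ idm X ;; g' ⊗₁ idm X.
Proof. by rewrite -tensmM comp1m. Qed.

Lemma tmX X X' Y Y' (f : Hom X X') (g : Hom Y Y') :
  f ⊗₁ idm Y ;; idm X' ⊗₁ g = idm X ⊗₁ g ;; f ⊗₁ idm Y'.
Proof. by rewrite -!tensmM !compm1 !comp1m. Qed.

Lemma inv_comp X Y Z (f : Hom X Y) f' (g : Hom Y Z) g' :
  inverses f f' -> inverses g g' -> inverses (f ;; g) (g' ;; f').
Proof.
move=> [a b] [c d]; split.
  by rewrite compA -(compA g) c comp1m a.
by rewrite compA -(compA f') b comp1m d.
Qed.

Lemma inv_tens X X' Y Y' (f : Hom X X') f' (g : Hom Y Y') g' :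
  inverses f f' -> inverses g g' -> inverses (f ⊗₁ g) (f' ⊗₁ g').
Proof.
by move=> [a b] [c d]; split; rewrite -tensmM ?a ?b ?c ?d tensm1.
Qed.

Lemma inv_sym X Y (f : Hom X Y) g : inverses f g -> inverses g f.
Proof. by case. Qed.

Lemma inv_id X : inverses (idm X) (idm X).
Proof. by split; rewrite comp1m. Qed.

Lemma iso_comp X Y Z (f : Hom X Y) (g : Hom Y Z) :
  is_iso f -> is_iso g -> is_iso (f ;; g).
Proof. by move=> [f' ?] [g' ?]; exists (g' ;; f'); apply: inv_comp. Qed.

Lemma iso_tens X X' Y Y' (f : Hom X X') (g : Hom Y Y') :
  is_iso f -> is_iso g -> is_iso (f ⊗₁ g).
Proof. by move=> [f' ?] [g' ?]; exists (f' ⊗₁ g'); apply: inv_tens. Qed.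

Lemma iso_id X : is_iso (idm X).
Proof. by exists (idm X); apply: inv_id. Qed.

Lemma iso_asso X Y Z : is_iso (asso X Y Z).
Proof. by exists (assoV X Y Z); apply: assoK. Qed.

Lemma iso_assoV X Y Z : is_iso (assoV X Y Z).
Proof. by exists (asso X Y Z); apply/inv_sym/assoK. Qed.

Lemma tens1_inj X Y (f g : Hom X Y) :
  idm 𝟙 ⊗₁ f = idm 𝟙 ⊗₁ g -> f = g.
Proof. by move=> e; apply: (epiiso (lunKr X)); rewrite -!lun_nat e. Qed.

Lemma tensr1_inj X Y (f g : Hom X Y) :
  f ⊗₁ idm 𝟙 = g ⊗₁ idm 𝟙 -> f = g.
Proof. by move=> e; apply: (epiiso (runKr X)); rewrite -!run_nat e. Qed.

Lemma lun_asso X Y : asso 𝟙 X Y ;; lun (X ⊗ Y) = lun X ⊗₁ idm Y.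
Proof.
apply: tens1_inj; rewrite tmMr.
apply: (epiiso (assoKr 𝟙 (𝟙 ⊗ X) Y)).
apply: (epiiso (u := asso 𝟙 𝟙 X ⊗₁ idm Y) (v := assoV 𝟙 𝟙 X ⊗₁ idm Y)).
  by rewrite -tmMl assoKr tensm1.
rewrite -asso_nat -[RHS]compA -tmMl triangle asso_nat tensm1.
rewrite -triangle -[RHS]compA -pentagon; by rewrite !compA.
Qed.

Lemma run_asso X Y : asso X Y 𝟙 ;; idm X ⊗₁ run Y = run (X ⊗ Y).
Proof.
apply: tensr1_inj; rewrite tmMl.
apply: (monoiso (assoKl X Y 𝟙)).
rewrite compA asso_nat -triangle tmMr.
rewrite -(triangle (X ⊗ Y) 𝟙) -[idm (X ⊗ Y)]tensm1 compA asso_nat.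
by rewrite -[RHS]compA -pentagon !compA.
Qed.

Lemma asso_lunV X Y : lunV X ⊗₁ idm Y ;; asso 𝟙 X Y = lunV (X ⊗ Y).
Proof.
apply: (monoiso (lunKl (X ⊗ Y))).
by rewrite compA lun_asso -tmMl !lunKr tensm1.
Qed.

Lemma assoV_lunV X Y : lunV (X ⊗ Y) ;; assoV 𝟙 X Y = lunV X ⊗₁ idm Y.
Proof. by rewrite -asso_lunV compA assoKl compm1. Qed.

Lemma assoV_runV X Y : idm X ⊗₁ runV Y ;; assoV X Y 𝟙 = runV (X ⊗ Y).
Proof.
apply: (monoiso (runKl (X ⊗ Y))).
by rewrite compA -run_asso -(compA (assoV X Y 𝟙)) assoKr comp1m -tmMr runKr
  run_asso runKr tensm1.
Qed.

End MoncatTheory.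

Section PentagonVariants.
Variables (k : fieldType) (C : moncat k).
Implicit Types X Y Z T : C.

Lemma pentagonV X Y Z T :
  idm X ⊗₁ assoV Y Z T ;; assoV X (Y ⊗ Z) T ;; assoV X Y Z ⊗₁ idm T
  = assoV X Y (Z ⊗ T) ;; assoV (X ⊗ Y) Z T.
Proof.
have i1 := inv_comp (inv_tens (assoK X Y Z) (inv_id T))
  (inv_comp (assoK X (Y ⊗ Z) T) (inv_tens (inv_id X) (assoK Y Z T))).
have i2 := inv_comp (assoK (X ⊗ Y) Z T) (assoK X Y (Z ⊗ T)).
rewrite pentagon in i1.
case: i1 i2 => [e1 _] [_ e2].
by rewrite -[LHS]comp1m -e2 compA -(compA (idm X ⊗₁ _)) e1 compm1.
Qed.

Lemma pentagon_VL X Y Z T :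
  assoV (X ⊗ Y) Z T ;; asso X Y Z ⊗₁ idm T
  = asso X Y (Z ⊗ T) ;; idm X ⊗₁ assoV Y Z T ;; assoV X (Y ⊗ Z) T.
Proof.
symmetry; apply: (movel (assoK (X ⊗ Y) Z T)).
rewrite -compA -pentagon !compA -!(compA (idm X ⊗₁ _)) -tmMr assoKl tensm1.
by rewrite comp1m assoKl compm1.
Qed.

Lemma pentagon_VV X Y Z T :
  assoV X (Y ⊗ Z) T ;; assoV X Y Z ⊗₁ idm T
  = idm X ⊗₁ asso Y Z T ;; assoV X Y (Z ⊗ T) ;; assoV (X ⊗ Y) Z T.
Proof.
by rewrite -pentagonV -compA -tmMr assoKl tensm1 comp1m.
Qed.

End PentagonVariants.

Section Center.
Variables (k : fieldType) (C : moncat k).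

(* Half-braidings go Y ⊗ X -> X ⊗ Y.                                          *)
Record center_ob := CenterOb {
  cob :> C;
  hb : forall Y, Hom (Y ⊗ cob) (cob ⊗ Y);
  hb_iso : forall Y, is_iso (hb Y);
  hb_nat : forall Y Y' (f : Hom Y Y'),
    f ⊗₁ idm cob ;; hb Y' = hb Y ;; idm cob ⊗₁ f;
  hb_tens : forall Y W, hb (Y ⊗ W) =
    asso Y W cob ;; idm Y ⊗₁ hb W ;; assoV Y cob W ;; hb Y ⊗₁ idm W ;;
    asso cob Y W }.

Definition hb_compat (X X' : center_ob) (f : Hom (cob X) (cob X')) : Prop :=
  forall Y, idm Y ⊗₁ f ;; hb X' Y = hb X Y ;; f ⊗₁ idm Y.

Fact hb_compat0 X X' : @hb_compat X X' 0.
Proof.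
move=> Y.
have tr0 : idm Y ⊗₁ (0 : Hom (cob X) (cob X')) = 0.
  have := tensm_linr (idm Y) (-1) (0 : Hom (cob X) (cob X')) 0.
  by rewrite scaler0 addr0 scaleN1r addNr.
have tl0 : (0 : Hom (cob X) (cob X')) ⊗₁ idm Y = 0.
  have := tensm_linl (idm Y) (-1) (0 : Hom (cob X) (cob X')) 0.
  by rewrite scaler0 addr0 scaleN1r addNr.
rewrite tr0 tl0.
have := comp_linl (hb X' Y) (-1) (0 : Hom (Y ⊗ X) (Y ⊗ X')) 0.
rewrite scaler0 addr0 scaleN1r addNr => ->.
have := comp_linr (hb X Y) (-1) (0 : Hom (X ⊗ Y) (X' ⊗ Y)) 0.
by rewrite scaler0 addr0 scaleN1r addNr => ->.
Qed.

Fact hb_compatP X X' a (f g : Hom (cob X) (cob X')) :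
  @hb_compat X X' f -> @hb_compat X X' g -> @hb_compat X X' (a *: f + g).
Proof.
move=> Hf Hg Y.
by rewrite tensm_linr tensm_linl comp_linl comp_linr Hf Hg.
Qed.

Definition hb_compat_space (X X' : center_ob) :=
  Subspace (@hb_compat0 X X') (@hb_compatP X X').

Definition center_hom (X X' : center_ob) : lmodType k :=
  subspace_type (hb_compat_space X X').

Definition chom (X X' : center_ob) (f : Hom (cob X) (cob X'))
  (Hf : @hb_compat X X' f) : center_hom X X' := 
  subspace_elt (S := hb_compat_space X X') Hf.

Lemma chomP (X X' : center_ob) (f : center_hom X X') :
  @hb_compat X X' (subspace_val f).
Proof. exact: (@subspace_valP _ _ (hb_compat_space X X')). Qed.

Fact hb_compat_id (X : center_ob) : @hb_compat X X (idm (cob X)).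
Proof. by move=> Y; rewrite !tensm1 comp1m compm1. Qed.

Fact hb_compat_comp (X Y Z : center_ob) f g :
  @hb_compat X Y f -> @hb_compat Y Z g -> @hb_compat X Z (f ;; g).
Proof.
by move=> Hf Hg W; rewrite tmMr tmMl compA Hg -compA Hf compA.
Qed.

Fact hb_compat_inv (X Y : center_ob) f g :
  inverses f g -> @hb_compat X Y f -> @hb_compat Y X g.
Proof.
move=> fg Hf W; have [_ gf] := fg.
have [iW _] := inv_tens fg (inv_id W).
apply: (monoiso iW); rewrite !compA -Hf -tmMl gf tensm1 compm1.
by rewrite -compA -tmMr gf tensm1 comp1m.
Qed.

Definition center_cat : lincat k.
Proof.
refine (@Lincat k center_ob center_hom
  (fun X => chom (@hb_compat_id X))
  (fun X Y Z f g => chom (hb_compat_comp (chomP f) (chomP g))) _ _ _ _ _).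
- by move=> X Y f; apply/val_inj/comp1m.
- by move=> X Y f; apply/val_inj/compm1.
- by move=> X Y Z T f g h; apply/val_inj/compA.
- by move=> X Y Z g a f f'; apply/val_inj/comp_linl.
- by move=> X Y Z f a g g'; apply/val_inj/comp_linr.
Defined.

Definition hb_one (Y : C) : Hom (Y ⊗ 𝟙) (𝟙 ⊗ Y) := run Y ;; lunV Y.

Fact hb_one_iso Y : is_iso (hb_one Y).
Proof.
exists (lun Y ;; runV Y).
exact: (inv_comp (runK Y) (inv_sym (lunK Y))).
Qed.

Fact lunV_nat X Y (f : @Hom k C X Y) : f ;; lunV Y = lunV X ;; idm 𝟙 ⊗₁ f.
Proof.
symmetry; apply: (mover (lunK Y)).
by rewrite compA lun_nat -compA lunKr comp1m.
Qed.

Fact hb_one_nat Y Y' (f : Hom Y Y') :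
  f ⊗₁ idm 𝟙 ;; hb_one Y' = hb_one Y ;; idm 𝟙 ⊗₁ f.
Proof. by rewrite /hb_one -compA run_nat compA lunV_nat compA. Qed.

Fact triangleV (X Y : C) : assoV X 𝟙 Y ;; run X ⊗₁ idm Y = idm X ⊗₁ lun Y.
Proof. by rewrite -triangle -compA assoKr comp1m. Qed.

Fact hb_one_tens Y W : hb_one (Y ⊗ W) =
  asso Y W 𝟙 ;; idm Y ⊗₁ hb_one W ;; assoV Y 𝟙 W ;; hb_one Y ⊗₁ idm W ;;
  asso 𝟙 Y W.
Proof.
rewrite /hb_one tmMr tmMl !compA asso_lunV (comp_rw _ (triangleV Y W)).
rewrite (comp_rw _ (esym (tmMr Y (lunV W) (lun W)))) lunKr tensm1 comp1m.
by rewrite (comp_rw _ (run_asso Y W)).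
Qed.

Definition center_one : center_ob :=
  CenterOb hb_one_iso hb_one_nat hb_one_tens.

Section Tensor.
Variables X X' : center_ob.

Definition hb_prod (Y : C) : Hom (Y ⊗ (X ⊗ X')) (X ⊗ X' ⊗ Y) :=
  assoV Y X X' ;; hb X Y ⊗₁ idm (cob X') ;; asso X Y X' ;;
  idm (cob X) ⊗₁ hb X' Y ;; assoV X X' Y.

Fact hb_prod_iso Y : is_iso (hb_prod Y).
Proof.
by do ![apply: iso_comp | apply: iso_tens | exact: iso_id | exact: iso_asso
  | exact: iso_assoV | exact: hb_iso].
Qed.

Fact hb_prod_nat Y Y' (f : Hom Y Y') :
  f ⊗₁ idm (X ⊗ X') ;; hb_prod Y' = hb_prod Y ;; idm (X ⊗ X') ⊗₁ f.
Proof.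
rewrite /hb_prod !compA -[idm (X ⊗ X')]tensm1 -assoV_nat.
rewrite (comp_rw _ (assoV_nat _ _ _)) !compA; congr (_ ;; _).
rewrite (comp_rw _ (esym (tmMl _ _ _))) hb_nat tmMl compA; congr (_ ;; _).
rewrite (comp_rw _ (asso_nat _ _ _)) !compA; congr (_ ;; _).
by rewrite (comp_rw _ (esym (tmMr _ _ _))) hb_nat tmMr compA.
Qed.

Fact hb_prod_tens Y W : hb_prod (Y ⊗ W) =
  asso Y W (X ⊗ X') ;; idm Y ⊗₁ hb_prod W ;; assoV Y (X ⊗ X') W ;;
  hb_prod Y ⊗₁ idm W ;; asso (X ⊗ X') Y W.
Proof.
rewrite /hb_prod !hb_tens !tmMl !tmMr !compA.
rewrite (comp_rw _ (pentagon_VL _ _ _ _)) !compA; congr (_ ;; _).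
congr (_ ;; _).
rewrite (comp_rw _ (esym (assoV_nat _ _ _))) !compA; congr (_ ;; _).
rewrite (comp_rw _ (pentagon_VV _ _ _ _)) !compA; congr (_ ;; _).
have pent u : asso X Y W ⊗₁ idm (cob X') ;; asso X (Y ⊗ W) X' ;;
    idm (cob X) ⊗₁ asso Y W X' ;; u
  = asso (X ⊗ Y) W X' ;; asso X Y (W ⊗ X') ;; u :> Hom _ (X ⊗ X' ⊗ (Y ⊗ W)).
  by rewrite -[in RHS]compA -pentagon !compA.
rewrite pent (comp_rw _ (asso_nat _ _ _)) compA.
rewrite (comp_rw _ (assoKr _ _ _)) comp1m tensm1.
rewrite (comp_rw _ (esym (asso_nat _ _ _))) compA tensm1.
rewrite (comp_rw _ (tmX _ _)) compA -[idm (Y ⊗ X)]tensm1.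
rewrite (comp_rw _ (esym (assoV_nat _ _ _))) compA; congr (_ ;; _).
have pentV u : idm Y ⊗₁ assoV X X' W ;; assoV Y (X ⊗ X') W ;;
    assoV Y X X' ⊗₁ idm W ;; u
  = assoV Y X (X' ⊗ W) ;; assoV (Y ⊗ X) X' W ;; u :> Hom _ (X ⊗ X' ⊗ (Y ⊗ W)).
  by rewrite -[in RHS]compA -pentagonV !compA.
rewrite pentV; congr (_ ;; _).
rewrite (comp_rw _ (esym (assoV_nat _ _ _))) compA tensm1; congr (_ ;; _).
rewrite (comp_rw _ (pentagon_VL _ _ _ _)) !compA; congr (_ ;; _).
congr (_ ;; _).
rewrite (comp_rw _ (esym (assoV_nat _ _ _))) !compA; congr (_ ;; _).
by rewrite (comp_rw _ (pentagon_VV _ _ _ _)) !compA assoKr compm1.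
Qed.

Definition center_tens : center_ob :=
  CenterOb hb_prod_iso hb_prod_nat hb_prod_tens.

End Tensor.

Fact hb_compat_tens (X Y X' Y' : center_ob) f g :
  @hb_compat X X' f -> @hb_compat Y Y' g ->
  @hb_compat (center_tens X Y) (center_tens X' Y') (f ⊗₁ g).
Proof.
move=> Hf Hg W; rewrite /= /hb_prod !compA.
rewrite (comp_rw _ (assoV_nat _ _ _)) !compA; congr (_ ;; _).
rewrite (comp_rw _ (esym (tensmM _ _ _ _))) Hf compm1 -{1}(comp1m g).
rewrite tensmM compA; congr (_ ;; _).
rewrite (comp_rw _ (asso_nat _ _ _)) !compA; congr (_ ;; _).
rewrite (comp_rw _ (esym (tensmM _ _ _ _))) Hg compm1 -{1}(comp1m f).
by rewrite tensmM compA assoV_nat.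
Qed.

Fact hb_compat_asso (X Y Z : center_ob) :
  @hb_compat (center_tens (center_tens X Y) Z)
    (center_tens X (center_tens Y Z)) (asso X Y Z).
Proof.
move=> W; rewrite /= /hb_prod !tmMl !tmMr !compA.
rewrite (comp_rw _ (pentagon_VV _ _ _ _)) !compA; congr (_ ;; _).
congr (_ ;; _).
rewrite -[idm (Y ⊗ Z)]tensm1.
rewrite (comp_rw _ (esym (assoV_nat _ _ _))) !compA; congr (_ ;; _).
rewrite (comp_rw _ (pentagon_VL _ _ _ _)) !compA; congr (_ ;; _).
congr (_ ;; _).
rewrite (comp_rw _ (esym (assoV_nat _ _ _))) !compA; congr (_ ;; _).
rewrite (comp_rw _ (pentagon_VV _ _ _ _)) !compA; congr (_ ;; _).
rewrite (comp_rw _ (assoKr _ _ _)) comp1m -[idm (X ⊗ Y)]tensm1.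
rewrite (comp_rw _ (esym (assoV_nat _ _ _))) !compA; congr (_ ;; _).
rewrite -(compA (assoV X Y _)) -pentagonV !compA -tmMl assoKr tensm1.
by rewrite compm1.
Qed.

Fact hb_compat_lun (X : center_ob) :
  @hb_compat (center_tens center_one X) X (lun X).
Proof.
move=> W; rewrite /= /hb_prod /= /hb_one !tmMl !compA.
rewrite (comp_rw _ (triangleV _ _)) (comp_rw _ (asso_lunV _ _)).
rewrite (comp_rw _ (esym (lunV_nat _))) compA (comp_rw _ (assoV_lunV _ _)).
by rewrite -tmMl lunKr tensm1 compm1.
Qed.

Fact hb_compat_run (X : center_ob) :
  @hb_compat (center_tens X center_one) X (run X).
Proof.
move=> W; rewrite /= /hb_prod /= /hb_one !tmMr !compA triangleV -tmMr lunKr.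
rewrite tensm1 compm1 run_asso run_nat.
by rewrite -run_asso compA (comp_rw _ (assoKr _ _ _)) comp1m.
Qed.

Definition center : moncat k.
Proof.
refine (@Moncat k center_cat center_one center_tens
  (fun X Y X' Y' f g => chom (hb_compat_tens (chomP f) (chomP g)))
  _ _ _ _
  (fun X Y Z => chom (hb_compat_asso X Y Z))
  (fun X Y Z => chom (@hb_compat_inv
     (center_tens (center_tens X Y) Z) (center_tens X (center_tens Y Z))
     _ _ (assoK _ _ _) (@hb_compat_asso X Y Z)))
  _ _
  (fun X => chom (hb_compat_lun X))
  (fun X => chom (@hb_compat_inv (center_tens center_one X) X
     _ _ (lunK _) (@hb_compat_lun X)))
  _ _
  (fun X => chom (hb_compat_run X))
  (fun X => chom (@hb_compat_inv (center_tens X center_one) X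
     _ _ (runK _) (@hb_compat_run X)))
  _ _ _ _).
- by move=> X Y; apply/val_inj/tensm1.
- by move=> X X' X'' Y Y' Y'' f f' g g'; apply/val_inj/tensmM.
- by move=> X Y X' Y' g a f f'; apply/val_inj/tensm_linl.
- by move=> X Y X' Y' f a g g'; apply/val_inj/tensm_linr.
- by move=> X Y Z; split; apply/val_inj; [exact: assoKl | exact: assoKr].
- by move=> X Y Z X' Y' Z' f g h; apply/val_inj/asso_nat.
- by move=> X; split; apply/val_inj; [exact: lunKl | exact: lunKr].
- by move=> X Y f; apply/val_inj/lun_nat.
- by move=> X; split; apply/val_inj; [exact: runKl | exact: runKr].
- by move=> X Y f; apply/val_inj/run_nat.
- by move=> X Y Z T; apply/val_inj/pentagon.
- by move=> X Y; apply/val_inj/triangle.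
Defined.

End Center.

Section TensorSubcategories.
Variables (k : fieldType) (C : moncat k).

(* Y is a left dual of X (and X a right dual of Y).                           *)
Definition is_dual (X Y : C) : Prop :=
  exists (ev : Hom (Y ⊗ X) 𝟙) (coev : Hom 𝟙 (X ⊗ Y)),
    coev ⊗₁ idm X ;; asso X Y X ;; idm X ⊗₁ ev = lun X ;; runV X /\
    idm Y ⊗₁ coev ;; assoV Y X Y ;; ev ⊗₁ idm Y = run Y ;; lunV Y.

Record tensor_subcat (P : C -> Prop) : Prop := TensorSubcat {
  ts_sq : subquotient_closed P;
  ts_one : P 𝟙;
  ts_tens : forall X Y, P X -> P Y -> P (X ⊗ Y);
  ts_dual : forall X Y, is_dual X Y -> P X <-> P Y }.

Definition tensor_generated (S : C -> Prop) (X : C) : Prop :=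
  forall P, tensor_subcat P -> (forall Y, S Y -> P Y) -> P X.

Lemma tensor_generated_subcat S : tensor_subcat (tensor_generated S).
Proof.
split.
- split=> [I X T sumT PX P tP SP | X Y f mf PY P tP SP | X Y f ef PX P tP SP].
  + by apply: (sq_sum (ts_sq tP) sumT) => j; apply: PX.
  + by apply: (sq_sub (ts_sq tP) mf); apply: PY.
  + by apply: (sq_quot (ts_sq tP) ef); apply: PX.
- by move=> P tP SP; apply: ts_one.
- by move=> X Y PX PY P tP SP; apply: (ts_tens tP); [apply: PX | apply: PY].
- move=> X Y dXY; split=> H P tP SP; apply/(ts_dual tP dXY); exact: H.
Qed.

Definition full_moncat (P : C -> Prop) (tP : tensor_subcat P) : moncat k :=
  @Moncat k (full_sub P) (exist P 𝟙 (ts_one tP))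
    (fun X Y => exist P (sval X ⊗ sval Y)
       (ts_tens tP (proj2_sig X) (proj2_sig Y)))
    (fun X Y X' Y' f g => f ⊗₁ g)
    (fun X Y => tensm1 (sval X) (sval Y))
    (fun X X' X'' Y Y' Y'' => @tensmM k C (sval X) (sval X') (sval X'')
       (sval Y) (sval Y') (sval Y''))
    (fun X Y X' Y' => @tensm_linl k C (sval X) (sval Y) (sval X') (sval Y'))
    (fun X Y X' Y' => @tensm_linr k C (sval X) (sval Y) (sval X') (sval Y'))
    (fun X Y Z => asso (sval X) (sval Y) (sval Z))
    (fun X Y Z => assoV (sval X) (sval Y) (sval Z))
    (fun X Y Z => assoK (sval X) (sval Y) (sval Z))
    (fun X Y Z X' Y' Z' => @asso_nat k C (sval X) (sval Y) (sval Z)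
       (sval X') (sval Y') (sval Z'))
    (fun X => lun (sval X)) (fun X => lunV (sval X))
    (fun X => lunK (sval X))
    (fun X Y => @lun_nat k C (sval X) (sval Y))
    (fun X => run (sval X)) (fun X => runV (sval X))
    (fun X => runK (sval X))
    (fun X Y => @run_nat k C (sval X) (sval Y))
    (fun X Y Z T => pentagon (sval X) (sval Y) (sval Z) (sval T))
    (fun X Y => triangle (sval X) (sval Y)).

End TensorSubcategories.

Record modcat (k : fieldType) (C : moncat k) := Modcat {
  mod_cat :> lincat k;
  act : C -> mod_cat -> mod_cat;
  actm : forall X X' M M',
    @Hom k C X X' -> Hom M M' -> Hom (act X M) (act X' M');
  actm1 : forall X M, actm (idm X) (idm M) = idm (act X M);
  actmM : forall X X' X'' M M' M'' (f : Hom X X') (f' : Hom X' X'')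
      (g : Hom M M') (g' : Hom M' M''),
    actm (f ;; f') (g ;; g') = actm f g ;; actm f' g';
  actm_linl : forall X X' M M' (g : Hom M M'),
    linear (fun f : Hom X X' => actm f g);
  actm_linr : forall X X' M M' (f : Hom X X'),
    linear (fun g : Hom M M' => actm f g);
  masso : forall X Y M, Hom (act (X ⊗ Y) M) (act X (act Y M));
  masso_iso : forall X Y M, is_iso (masso X Y M);
  masso_nat : forall X Y M X' Y' M' (f : Hom X X') (g : Hom Y Y')
      (h : Hom M M'),
    actm (f ⊗₁ g) h ;; masso X' Y' M' = masso X Y M ;; actm f (actm g h);
  munit : forall M, Hom (act 𝟙 M) M;
  munit_iso : forall M, is_iso (munit M);
  munit_nat : forall M M' (f : Hom M M'),
    actm (idm 𝟙) f ;; munit M' = munit M ;; f;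
  mpentagon : forall X Y Z M,
    actm (asso X Y Z) (idm M) ;; masso X (Y ⊗ Z) M ;;
      actm (idm X) (masso Y Z M)
    = masso (X ⊗ Y) Z M ;; masso X Y (act Z M);
  mtriangle : forall X M,
    masso X 𝟙 M ;; actm (idm X) (munit M) = actm (run X) (idm M) }.

Arguments act {k C m} X M.
Arguments actm {k C m X X' M M'} f g.
Arguments masso {k C m} X Y M.
Arguments munit {k C m} M.

Section ModcatNotions.
Variables (k : fieldType) (C : moncat k).

Record module_subcat (M : modcat C) := ModuleSubcat {
  ms_mem :> M -> Prop;
  ms_sq : subquotient_closed ms_mem;
  ms_act : forall X N, ms_mem N -> ms_mem (act X N) }.

Definition submodcat (M : modcat C) (D : module_subcat M) : modcat C :=
  @Modcat k C (full_sub D)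
    (fun X N => exist D (act X (sval N)) (ms_act X (proj2_sig N)))
    (fun X X' N N' f g => actm f g)
    (fun X N => actm1 X (sval N))
    (fun X X' X'' N N' N'' =>
       @actmM k C M X X' X'' (sval N) (sval N') (sval N''))
    (fun X X' N N' => @actm_linl k C M X X' (sval N) (sval N'))
    (fun X X' N N' => @actm_linr k C M X X' (sval N) (sval N'))
    (fun X Y N => masso X Y (sval N))
    (fun X Y N => masso_iso X Y (sval N))
    (fun X Y N X' Y' N' =>
       @masso_nat k C M X Y (sval N) X' Y' (sval N'))
    (fun N => munit (sval N))
    (fun N => munit_iso (sval N))
    (fun N N' => @munit_nat k C M (sval N) (sval N'))
    (fun X Y Z N => mpentagon X Y Z (sval N))
    (fun X N => mtriangle X (sval N)).

Definition decomposes (M : modcat C) (I : finType)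
    (D : I -> module_subcat M) : Prop :=
  (forall N : M, exists2 P : I -> M,
     forall i, D i (P i) & is_direct_sum P N) /\
  (forall i j, i != j -> forall N P : M, D i N -> D j P ->
     forall f : Hom N P, f = 0).

(* The two summands of a decomposition are indexed by bool.                    *)
Definition indecomposable (M : modcat C) : Prop :=
  (exists N : M, ~ is_zero N) /\
  forall D : bool -> module_subcat M, decomposes D ->
    exists b, forall N : M, D b N -> is_zero N.

(* C as a left module category over its tensor subcategory P, by X ⊗ -.       *)
Definition regular_modcat (P : C -> Prop) (tP : tensor_subcat P) :
    modcat (full_moncat tP) :=
  @Modcat k (full_moncat tP) C
    (fun X M => sval X ⊗ M)
    (fun X X' M M' f g => @tensm k C (sval X) M (sval X') M' f g)
    (fun X M => tensm1 (sval X) M)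
    (fun X X' X'' => @tensmM k C (sval X) (sval X') (sval X''))
    (fun X X' M M' => @tensm_linl k C (sval X) M (sval X') M')
    (fun X X' M M' => @tensm_linr k C (sval X) M (sval X') M')
    (fun X Y M => asso (sval X) (sval Y) M)
    (fun X Y M => iso_asso (sval X) (sval Y) M)
    (fun X Y M X' Y' => @asso_nat k C (sval X) (sval Y) M (sval X') (sval Y'))
    (fun M => lun M)
    (fun M => ex_intro _ (lunV M) (lunK M))
    (fun M M' => @lun_nat k C M M')
    (fun X Y Z M => pentagon (sval X) (sval Y) (sval Z) M)
    (fun X M => triangle (sval X) M).

End ModcatNotions.

Record braiding (k : fieldType) (C : moncat k) := Braiding {
  br : forall X Y : C, Hom (X ⊗ Y) (Y ⊗ X);
  brV : forall X Y : C, Hom (Y ⊗ X) (X ⊗ Y);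
  brK : forall X Y, inverses (br X Y) (brV X Y);
  br_nat : forall (X Y X' Y' : C) (f : Hom X X') (g : Hom Y Y'),
    f ⊗₁ g ;; br X' Y' = br X Y ;; g ⊗₁ f;
  hexagonl : forall X Y Z : C,
    br (X ⊗ Y) Z = asso X Y Z ;; idm X ⊗₁ br Y Z ;; assoV X Z Y ;;
      br X Z ⊗₁ idm Y ;; asso Z X Y;
  hexagonr : forall X Y Z : C,
    br X (Y ⊗ Z) = assoV X Y Z ;; br X Y ⊗₁ idm Z ;; asso Y X Z ;;
      idm Y ⊗₁ br X Z ;; assoV Y Z X }.

Section Braided.
Variables (k : fieldType) (C : moncat k) (c : braiding C).

Definition hb_br (X Y : C) : Hom (Y ⊗ X) (X ⊗ Y) := br c Y X.
Definition hb_brV (X Y : C) : Hom (Y ⊗ X) (X ⊗ Y) := brV c X Y.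

Fact hb_br_iso X Y : is_iso (hb_br X Y).
Proof. by exists (brV c Y X); apply: brK. Qed.

Fact hb_br_nat X Y Y' (f : Hom Y Y') :
  f ⊗₁ idm X ;; hb_br X Y' = hb_br X Y ;; idm X ⊗₁ f.
Proof. exact: br_nat. Qed.

Fact hb_br_tens X Y W : hb_br X (Y ⊗ W) =
  asso Y W X ;; idm Y ⊗₁ hb_br X W ;; assoV Y X W ;; hb_br X Y ⊗₁ idm W ;;
  asso X Y W.
Proof. exact: hexagonl. Qed.

Fact hb_brV_iso X Y : is_iso (hb_brV X Y).
Proof. by exists (br c X Y); apply/inv_sym/brK. Qed.

Fact hb_brV_nat X Y Y' (f : Hom Y Y') :
  f ⊗₁ idm X ;; hb_brV X Y' = hb_brV X Y ;; idm X ⊗₁ f.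
Proof.
rewrite /hb_brV; apply: (movel (brK c X Y)); symmetry.
rewrite -compA; apply: (mover (brK c X Y')).
exact: br_nat.
Qed.

Fact hb_brV_tens X Y W : hb_brV X (Y ⊗ W) =
  asso Y W X ;; idm Y ⊗₁ hb_brV X W ;; assoV Y X W ;; hb_brV X Y ⊗₁ idm W ;;
  asso X Y W.
Proof.
rewrite /hb_brV.
have i := inv_comp (inv_sym (assoK X Y W)) (inv_comp
  (inv_tens (brK c X Y) (inv_id W)) (inv_comp (assoK Y X W) (inv_comp
  (inv_tens (inv_id Y) (brK c X W)) (inv_sym (assoK Y W X))))).
rewrite -hexagonr in i.
have [_ j] := brK c X (Y ⊗ W); case: i => i _.
by rewrite -[LHS]compm1 -i -compA j comp1m !compA.
Qed.

(* (X, c_{-,X}) *)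
Definition center_br (X : C) : center C :=
  CenterOb (@hb_br_iso X) (@hb_br_nat X) (@hb_br_tens X).

(* (X, c_{X,-}^{-1}) *)
Definition center_brV (X : C) : center C :=
  CenterOb (@hb_brV_iso X) (@hb_brV_nat X) (@hb_brV_tens X).

(* tilde is C ⊠_{C'} C^rev, realized inside the center as the smallest tensor  *)
(* subcategory containing the two copies (X, c_{-,X}) and (X, c_{X,-}^{-1})    *)
(* of C.                                                                       *)
Definition tilde_gen (Z : center C) : Prop :=
  exists X : C, Z = center_br X \/ Z = center_brV X.

Definition tilde_mem : center C -> Prop := tensor_generated tilde_gen.

Definition tilde : moncat k := full_moncat (tensor_generated_subcat tilde_gen).

Definition center_modcat : modcat tilde :=
  regular_modcat (tensor_generated_subcat tilde_gen).

End Braided.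

Section TensorMatrices.
Variable k : fieldType.

Lemma nth_allpairs (S T U : Type) (f : S -> T -> U) x0 y0 z0 s t i j :
  (i < size s)%N -> (j < size t)%N ->
  nth z0 [seq f x y | x <- s, y <- t] (i * size t + j) =
  f (nth x0 s i) (nth y0 t j).
Proof.
elim: s i => [//|x s IH] [|i] /= lti ltj; rewrite nth_cat size_map.
  by rewrite mul0n add0n ltj (nth_map y0).
by rewrite mulSn -addnA ltnNge leq_addr /= addKn IH.
Qed.

Lemma ord_cast m n (e : m = n) (x : 'I_m) : cast_ord e x = x :> nat.
Proof. by []. Qed.

Lemma mxvec_index_val m n (i : 'I_m) (j : 'I_n) :
  mxvec_index i j = (i * n + j)%N :> nat.
Proof.
have lt : (i * n + j < m * n)%N.
  apply: leq_trans (_ : i.+1 * n <= _)%N; last by rewrite leq_mul2r ltn_ord orbT.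
  by rewrite mulSn addnC ltn_add2r.
suff -> : mxvec_index i j = Ordinal lt by [].
rewrite /mxvec_index; apply: (canLR (cast_ordKV _)).
apply: (canLR enum_valK); rewrite (enum_val_nth (i, j)) /=.
rewrite enumT unlock /= /prod_enum.
have -> : (i * n + j = i * size (enum 'I_n) + j)%N by rewrite size_enum_ord.
by rewrite (nth_allpairs _ i j) ?size_enum_ord // !nth_ord_enum.
Qed.

Lemma trow_entry m p q (A : 'rV[k]_m) (B : 'M[k]_(p, q)) j u v :
  trow A B u (mxvec_index j v) = A 0 j * B u v.
Proof.
elim: m A j => [|m IH] A j; first by case: j.
rewrite /= -[j](@splitK 1 m).
case: (@split 1 m j) => j' /=.
  have -> : mxvec_index (lshift m j') v = lshift (m * q) v.
    by apply/val_inj/(etrans (mxvec_index_val _ _)); rewrite /= ord1 mul0n.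
  by rewrite row_mxEl !mxE ord1.
have -> : mxvec_index (rshift 1 j') v = rshift q (mxvec_index j' v).
  apply/val_inj/(etrans (mxvec_index_val _ _)).
  by rewrite -[RHS]/(q + mxvec_index j' v)%N mxvec_index_val mulSn addnA.
by rewrite row_mxEr IH mxE.
Qed.

Lemma tprod_entry m n p q (A : 'M[k]_(m, n)) (B : 'M[k]_(p, q)) i j u v :
  tprod A B (mxvec_index i u) (mxvec_index j v) = A i j * B u v.
Proof.
elim: m A i => [|m IH] A i; first by case: i.
rewrite /= -[i](@splitK 1 m).
case: (@split 1 m i) => i' /=.
  have -> : mxvec_index (lshift m i') u = lshift (m * p) u.
    by apply/val_inj/(etrans (mxvec_index_val _ _)); rewrite /= ord1 mul0n.
  by rewrite col_mxEu trow_entry !mxE ord1.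
have -> : mxvec_index (rshift 1 i') u = rshift p (mxvec_index i' u).
  apply/val_inj/(etrans (mxvec_index_val _ _)).
  by rewrite -[RHS]/(p + mxvec_index i' u)%N mxvec_index_val mulSn addnA.
by rewrite col_mxEd IH mxE.
Qed.

Lemma tprod_linl m n p q (B : 'M[k]_(p, q)) :
  linear (fun A : 'M[k]_(m, n) => tprod A B).
Proof.
move=> a A A'; apply/matrixP=> x y.
case/mxvec_indexP: x => i u; case/mxvec_indexP: y => j v.
by rewrite mxE [in RHS]mxE !tprod_entry !mxE mulrDl mulrA.
Qed.

Lemma tprod_linr m n p q (A : 'M[k]_(m, n)) :
  linear (fun B : 'M[k]_(p, q) => tprod A B).
Proof.
move=> a B B'; apply/matrixP=> x y.
case/mxvec_indexP: x => i u; case/mxvec_indexP: y => j v.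
by rewrite mxE [in RHS]mxE !tprod_entry !mxE mulrDr mulrCA.
Qed.

(* tprod is the Kronecker product with row-major indexing, which is strictly   *)
(* associative and unital up to the casts along m * n * p = m * (n * p),       *)
(* 1 * n = n and n * 1 = n: idcast is the resulting structure isomorphism.     *)
Definition idcast m n (e : m = n) : 'M[k]_(m, n) := castmx (erefl m, e) 1%:M.

Lemma mul_idcast m n p (e : m = n) (A : 'M[k]_(n, p)) :
  idcast e *m A = castmx (esym e, erefl p) A.
Proof. by case: n / e A => A; rewrite /idcast !castmx_id mul1mx. Qed.

Lemma mulmx_idcast m n p (e : n = p) (A : 'M[k]_(m, n)) :
  A *m idcast e = castmx (erefl m, e) A.
Proof. by case: p / e; rewrite /idcast !castmx_id mulmx1. Qed.

Lemma idcast_comp m n p (e : m = n) (e' : n = p) :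
  idcast e *m idcast e' = idcast (etrans e e').
Proof. by case: p / e'; rewrite mulmx_idcast castmx_id. Qed.

Lemma idcast_id m (e : m = m) : idcast e = 1%:M.
Proof. by rewrite /idcast castmx_id. Qed.

Lemma idcast_irr m n (e e' : m = n) : idcast e = idcast e'.
Proof. by congr idcast; apply: eq_irrelevance. Qed.

Lemma tprod_idcastl m n p (e : m = n) :
  tprod (idcast e) (1%:M : 'M[k]_p) = idcast (congr1 (muln^~ p) e).
Proof. by case: n / e => /=; rewrite !idcast_id tprod1. Qed.

Lemma tprod_idcastr m n p (e : m = n) :
  tprod (1%:M : 'M[k]_p) (idcast e) = idcast (congr1 (muln p) e).
Proof. by case: n / e => /=; rewrite !idcast_id tprod1. Qed.

Lemma tprodA m n p m' n' p' (A : 'M[k]_(m, m')) (B : 'M[k]_(n, n'))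
    (D : 'M[k]_(p, p')) :
  tprod (tprod A B) D *m idcast (esym (mulnA m' n' p'))
  = idcast (esym (mulnA m n p)) *m tprod A (tprod B D).
Proof.
rewrite mul_idcast mulmx_idcast; apply/matrixP=> x y.
rewrite !castmxE cast_ord_id /= cast_ord_id.
case/mxvec_indexP: x => x d; case/mxvec_indexP: x => a b.
case/mxvec_indexP: y => a' y; case/mxvec_indexP: y => b' d'.
have -> : cast_ord (esym (esym (mulnA m' n' p')))
    (mxvec_index a' (mxvec_index b' d'))
  = mxvec_index (mxvec_index a' b') d'.
  by apply: ord_inj; rewrite ord_cast !mxvec_index_val mulnDl addnA mulnA.
have -> : cast_ord (esym (esym (esym (mulnA m n p))))
    (mxvec_index (mxvec_index a b) d)
  = mxvec_index a (mxvec_index b d).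
  by apply: ord_inj; rewrite ord_cast !mxvec_index_val mulnDl addnA mulnA.
by rewrite !tprod_entry mulrA.
Qed.

Lemma tprod1l m n (A : 'M[k]_(m, n)) :
  tprod (1%:M : 'M[k]_1) A *m idcast (mul1n n) = idcast (mul1n m) *m A.
Proof.
rewrite mul_idcast mulmx_idcast; apply/matrixP=> x y.
rewrite !castmxE cast_ord_id /= cast_ord_id.
case/mxvec_indexP: x => i x.
have -> : cast_ord (esym (mul1n n)) y = mxvec_index ord0 y.
  by apply: ord_inj; rewrite ord_cast mxvec_index_val mul0n.
have -> : cast_ord (esym (esym (mul1n m))) (mxvec_index i x) = x.
  by apply: ord_inj; rewrite ord_cast mxvec_index_val ord1 mul0n.
by rewrite tprod_entry !mxE ord1 eqxx mul1r.
Qed.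

Lemma tprod1r m n (A : 'M[k]_(m, n)) :
  tprod A (1%:M : 'M[k]_1) *m idcast (muln1 n) = idcast (muln1 m) *m A.
Proof.
rewrite mul_idcast mulmx_idcast; apply/matrixP=> x y.
rewrite !castmxE cast_ord_id /= cast_ord_id.
case/mxvec_indexP: x => x i.
have -> : cast_ord (esym (muln1 n)) y = mxvec_index y ord0.
  by apply: ord_inj; rewrite ord_cast mxvec_index_val muln1 addn0.
have -> : cast_ord (esym (esym (muln1 m))) (mxvec_index x i) = x.
  by apply: ord_inj; rewrite ord_cast mxvec_index_val ord1 muln1 addn0.
by rewrite tprod_entry !mxE ord1 eqxx mulr1.
Qed.

(* The flip e_i ⊗ e_j |-> e_j ⊗ e_i, for the identification mxvec of          *)
(* 'M_(m, n) with k^m ⊗ k^n.                                                  *)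
Definition flip m n : 'M[k]_(m * n, n * m) := lin_mx (@trmx k m n).

Lemma flipE m n (i i' : 'I_m) (j j' : 'I_n) :
  flip m n (mxvec_index i j) (mxvec_index j' i') = ((i == i') && (j == j'))%:R.
Proof.
have -> : flip m n (mxvec_index i j) (mxvec_index j' i')
    = row (mxvec_index i j) (flip m n) 0 (mxvec_index j' i') by rewrite [RHS]mxE.
rewrite rowE -mxvec_delta mul_vec_lin mxvecE !mxE.
by rewrite (eq_sym i') (eq_sym j').
Qed.

Lemma mul_flip m n p (A : 'M[k]_(n * m, p)) i j x :
  (flip m n *m A) (mxvec_index i j) x = A (mxvec_index j i) x.
Proof.
rewrite mxE (bigD1 (mxvec_index j i)) //= flipE !eqxx mul1r big1 ?addr0 // => y.
case/mxvec_indexP: y => j' i' ne; rewrite flipE.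
case: eqP => [ei|_]; last by rewrite mul0r.
case: eqP => [ej|_]; last by rewrite mul0r.
by rewrite ei ej eqxx in ne.
Qed.

Lemma mulmx_flip m n p (A : 'M[k]_(p, m * n)) i j x :
  (A *m flip m n) x (mxvec_index j i) = A x (mxvec_index i j).
Proof.
rewrite mxE (bigD1 (mxvec_index i j)) //= flipE !eqxx mulr1 big1 ?addr0 // => y.
case/mxvec_indexP: y => i' j' ne; rewrite flipE.
case: eqP => [ei|_]; last by rewrite mulr0.
case: eqP => [ej|_]; last by rewrite mulr0.
by rewrite ei ej eqxx in ne.
Qed.

Lemma flip_nat m n p q (A : 'M[k]_(m, n)) (B : 'M[k]_(p, q)) :
  tprod A B *m flip n q = flip m p *m tprod B A.
Proof.
apply/matrixP=> x y.
case/mxvec_indexP: x => i u; case/mxvec_indexP: y => v j.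
by rewrite mul_flip mulmx_flip !tprod_entry mulrC.
Qed.

Lemma flipK m n : flip m n *m flip n m = 1%:M.
Proof.
apply/matrixP=> x y.
case/mxvec_indexP: x => i j; case/mxvec_indexP: y => i' j'.
rewrite mul_flip flipE mxE /mxvec_index.
by rewrite (inj_eq (@cast_ord_inj _ _ _)) (inj_eq enum_rank_inj) andbC.
Qed.

Lemma mul_tprod1flip m n p q (A : 'M[k]_(m * (p * n), q)) i j l x :
  (tprod (1%:M : 'M_m) (flip n p) *m A) (mxvec_index i (mxvec_index j l)) x
  = A (mxvec_index i (mxvec_index l j)) x.
Proof.
rewrite mxE (bigD1 (mxvec_index i (mxvec_index l j))) //=.
rewrite tprod_entry flipE mxE !eqxx mulr1 mul1r big1 ?addr0 // => y.
case/mxvec_indexP: y => i' y; case/mxvec_indexP: y => l' j' ne.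
rewrite tprod_entry flipE mxE.
case: eqP => [ei|_]; last by rewrite !mul0r.
case: eqP => [ej|_]; last by rewrite mulr0 mul0r.
case: eqP => [el|_]; last by rewrite mulr0 mul0r.
by rewrite ei ej el eqxx in ne.
Qed.

Lemma mul_tprodflip1 m n p q (A : 'M[k]_(n * m * p, q)) i j l x :
  (tprod (flip m n) (1%:M : 'M_p) *m A) (mxvec_index (mxvec_index i j) l) x
  = A (mxvec_index (mxvec_index j i) l) x.
Proof.
rewrite mxE (bigD1 (mxvec_index (mxvec_index j i) l)) //=.
rewrite tprod_entry flipE mxE !eqxx !mul1r big1 ?addr0 // => y.
case/mxvec_indexP: y => y l'; case/mxvec_indexP: y => j' i' ne.
rewrite tprod_entry flipE mxE.
case: eqP => [ei|_]; last by rewrite !mul0r.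
case: eqP => [ej|_]; last by rewrite !mul0r.
case: eqP => [el|_]; last by rewrite mulr0 mul0r.
by rewrite ei ej el eqxx in ne.
Qed.

Lemma mxvec_indexA m n p (e : (m * n * p = m * (n * p))%N) i j l :
  cast_ord e (mxvec_index (mxvec_index i j) l)
  = mxvec_index i (mxvec_index j l).
Proof.
by apply: ord_inj; rewrite ord_cast !mxvec_index_val mulnDl addnA mulnA.
Qed.

Lemma mxvec_indexAV m n p (e : (m * (n * p) = m * n * p)%N) i j l :
  cast_ord e (mxvec_index i (mxvec_index j l))
  = mxvec_index (mxvec_index i j) l.
Proof.
by apply: ord_inj; rewrite ord_cast !mxvec_index_val mulnDl addnA mulnA.
Qed.

Lemma mul_idcastE m n p (e : m = n) (A : 'M[k]_(n, p)) x y :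
  (idcast e *m A) x y = A (cast_ord e x) y.
Proof. by rewrite mul_idcast castmxE esymK cast_ord_id. Qed.

Lemma flip_hexagonl m n p (e1 : (m * n * p = m * (n * p))%N)
    (e2 : (m * (p * n) = m * p * n)%N) (e3 : (p * m * n = p * (m * n))%N) :
  flip (m * n) p = idcast e1 *m (tprod 1%:M (flip n p) *m (idcast e2 *m
    (tprod (flip m p) 1%:M *m idcast e3))).
Proof.
rewrite -[flip (m * n) p]mulmx1 -[idcast e3]mulmx1; apply/matrixP=> x y.
case/mxvec_indexP: x => x l; case/mxvec_indexP: x => i j.
rewrite mul_flip mul_idcastE mxvec_indexA mul_tprod1flip.
rewrite mul_idcastE mxvec_indexAV mul_tprodflip1.
by rewrite mul_idcastE mxvec_indexA.
Qed.

Lemma flip_hexagonr m n p (e1 : (m * (n * p) = m * n * p)%N)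
    (e2 : (n * m * p = n * (m * p))%N) (e3 : (n * (p * m) = n * p * m)%N) :
  flip m (n * p) = idcast e1 *m (tprod (flip m n) 1%:M *m (idcast e2 *m
    (tprod 1%:M (flip m p) *m idcast e3))).
Proof.
rewrite -[flip m (n * p)]mulmx1 -[idcast e3]mulmx1; apply/matrixP=> x y.
case/mxvec_indexP: x => i x; case/mxvec_indexP: x => j l.
rewrite mul_flip mul_idcastE mxvec_indexAV mul_tprodflip1.
rewrite mul_idcastE mxvec_indexA mul_tprod1flip.
by rewrite mul_idcastE mxvec_indexAV.
Qed.

End TensorMatrices.

Section Rep.
Variables (k : fieldType) (gT : finGroupType) (G : {group gT}).

Local Notation rep := (representation k G).

Definition intertwines (X Y : rep) (f : 'M[k]_(rdegree X, rdegree Y)) : Prop :=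
  forall g, g \in G -> X g *m f = f *m Y g.

Fact intertwines0 X Y : @intertwines X Y 0.
Proof. by move=> g _; rewrite mulmx0 mul0mx. Qed.

Fact intertwinesP X Y a f g :
  @intertwines X Y f -> @intertwines X Y g -> @intertwines X Y (a *: f + g).
Proof.
move=> Hf Hg x Gx.
by rewrite mulmxDr mulmxDl -scalemxAr -scalemxAl Hf // Hg.
Qed.

Definition intertwines_space (X Y : rep) :=
  Subspace (@intertwines0 X Y) (@intertwinesP X Y).

Definition rep_hom (X Y : rep) : lmodType k :=
  subspace_type (intertwines_space X Y).

Definition rhom (X Y : rep) f (Hf : @intertwines X Y f) : rep_hom X Y :=
  subspace_elt (S := intertwines_space X Y) Hf.

Lemma rhomP (X Y : rep) (f : rep_hom X Y) : @intertwines X Y (subspace_val f).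
Proof. exact: (@subspace_valP _ _ (intertwines_space X Y)). Qed.

Fact intertwines1 (X : rep) : @intertwines X X 1%:M.
Proof. by move=> g _; rewrite mulmx1 mul1mx. Qed.

Fact intertwinesM (X Y Z : rep) f g :
  @intertwines X Y f -> @intertwines Y Z g -> @intertwines X Z (f *m g).
Proof. by move=> Hf Hg x Gx; rewrite mulmxA Hf // -[LHS]mulmxA Hg // mulmxA. Qed.

(* mx_representations act on row vectors, on the right, so the matrix of      *)
(* f ;; g is f *m g.                                                          *)
Definition Rep_cat : lincat k.
Proof.
refine (@Lincat k rep rep_hom
  (fun X => rhom (@intertwines1 X))
  (fun X Y Z f g => rhom (intertwinesM (rhomP f) (rhomP g))) _ _ _ _ _).
- by move=> X Y f; apply/val_inj/mul1mx.
- by move=> X Y f; apply/val_inj/mulmx1.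
- by move=> X Y Z T f g h; apply/val_inj/esym/mulmxA.
- move=> X Y Z g a f f'; apply/val_inj.
  by rewrite /= mulmxDl -scalemxAl.
- move=> X Y Z f a g g'; apply/val_inj.
  by rewrite /= mulmxDr -scalemxAr.
Defined.

Fact triv_mx_repr : mx_repr G (fun _ : gT => 1%:M : 'M[k]_1).
Proof. by split=> // g h _ _; rewrite mulmx1. Qed.

Definition rep_one : rep := Representation (MxRepresentation triv_mx_repr).

Definition rep_tens (X Y : rep) : rep := Representation (prod_repr X Y).

Fact intertwines_tens (X Y X' Y' : rep) f g :
  @intertwines X X' f -> @intertwines Y Y' g ->
  @intertwines (rep_tens X Y) (rep_tens X' Y') (tprod f g).
Proof. by move=> Hf Hg x Gx; rewrite /= -!tprodE (Hf _ Gx) (Hg _ Gx). Qed.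

Fact intertwines_asso (X Y Z : rep) :
  @intertwines (rep_tens (rep_tens X Y) Z) (rep_tens X (rep_tens Y Z))
    (idcast k (esym (mulnA _ _ _))).
Proof. by move=> x Gx; apply: tprodA. Qed.

Fact intertwines_lun (X : rep) :
  @intertwines (rep_tens rep_one X) X (idcast k (mul1n _)).
Proof. by move=> x Gx; apply: tprod1l. Qed.

Fact intertwines_run (X : rep) :
  @intertwines (rep_tens X rep_one) X (idcast k (muln1 _)).
Proof. by move=> x Gx; apply: tprod1r. Qed.

Fact intertwines_flip (X Y : rep) :
  @intertwines (rep_tens X Y) (rep_tens Y X) (flip k _ _).
Proof. by move=> x Gx; apply: flip_nat. Qed.

Fact intertwinesV (X Y : rep) (e : rdegree X = rdegree Y) :
  @intertwines X Y (idcast k e) -> @intertwines Y X (idcast k (esym e)).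
Proof.
move=> He x Gx.
rewrite -[X x]mulmx1 -(idcast_id k (etrans e (esym e))) -idcast_comp.
rewrite (mulmxA (X x)) He // !mulmxA idcast_comp idcast_id mul1mx.
by [].
Qed.

Definition Rep : moncat k.
Proof.
refine (@Moncat k Rep_cat rep_one rep_tens
  (fun X Y X' Y' f g => rhom (intertwines_tens (rhomP f) (rhomP g)))
  _ _ _ _
  (fun X Y Z => rhom (@intertwines_asso X Y Z))
  (fun X Y Z => rhom (intertwinesV (@intertwines_asso X Y Z)))
  _ _
  (fun X => rhom (@intertwines_lun X))
  (fun X => rhom (intertwinesV (@intertwines_lun X)))
  _ _
  (fun X => rhom (@intertwines_run X))
  (fun X => rhom (intertwinesV (@intertwines_run X)))
  _ _ _ _).
- by move=> X Y; apply/val_inj/tprod1.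
- by move=> X X' X'' Y Y' Y'' f f' g g'; apply/val_inj/tprodE.
- by move=> X Y X' Y' g a f f'; apply/val_inj/tprod_linl.
- by move=> X Y X' Y' f a g g'; apply/val_inj/tprod_linr.
- by move=> X Y Z; split; apply/val_inj; rewrite /= idcast_comp idcast_id.
- by move=> X Y Z X' Y' Z' f g h; apply/val_inj/tprodA.
- by move=> X; split; apply/val_inj; rewrite /= idcast_comp idcast_id.
- by move=> X Y f; apply/val_inj/tprod1l.
- by move=> X; split; apply/val_inj; rewrite /= idcast_comp idcast_id.
- by move=> X Y f; apply/val_inj/tprod1r.
- move=> X Y Z T; apply/val_inj.
  by rewrite /= tprod_idcastl tprod_idcastr !idcast_comp; apply: idcast_irr.
- move=> X Y; apply/val_inj.
  by rewrite /= tprod_idcastl tprod_idcastr idcast_comp; apply: idcast_irr.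
Defined.

Definition rep_br (X Y : Rep) : Hom (X ⊗ Y) (Y ⊗ X) :=
  rhom (@intertwines_flip X Y).

Fact rep_hexagonl (X Y Z : Rep) :
  rep_br (X ⊗ Y) Z = asso X Y Z ;; idm X ⊗₁ rep_br Y Z ;; assoV X Z Y ;;
    rep_br X Z ⊗₁ idm Y ;; asso Z X Y.
Proof. exact/val_inj/flip_hexagonl. Qed.

Fact rep_hexagonr (X Y Z : Rep) :
  rep_br X (Y ⊗ Z) = assoV X Y Z ;; rep_br X Y ⊗₁ idm Z ;; asso Y X Z ;;
    idm Y ⊗₁ rep_br X Z ;; assoV Y Z X.
Proof. exact/val_inj/flip_hexagonr. Qed.

Definition Rep_braiding : braiding Rep.
Proof.
refine (@Braiding k Rep rep_br (fun X Y => rep_br Y X)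
  _ _ rep_hexagonl rep_hexagonr).
- by move=> X Y; split; apply/val_inj/flipK.
- by move=> X Y X' Y' f g; apply/val_inj/flip_nat.
Defined.

End Rep.

Arguments Rep k {gT} G.
Arguments Rep_braiding k {gT} G.

(* Main.v *)
From mathcomp Require Import all_boot all_order all_algebra all_fingroup.
From mathcomp Require Import all_character.
From mathcomp Require Import boolp.
Require Import Defs.

(** A half-braiding on a representation X of G is the same thing as a grading
    X = ⊕_(g in G) X_g with X_g·h = X_(g^h): by naturality with respect to the
    morphisms k[G] -> Y, e_a |-> y·a, it is determined by its value on the
    regular representation, and it has the form
    y ⊗ x |-> \sum_g x_g ⊗ y·g. The projections x |-> x_g ([hproj]) are
    extracted in [hbME]; the hexagon axiom makes them orthogonal idempotents,
    invertibility at the unit object makes them sum to 1, and equivariance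
    permutes them by conjugation ([hproj_grading]). Conversely a grading gives
    an object of the center ([yd_object]), and the morphisms of the center are
    the intertwiners that preserve degrees ([hom_hproj], [hom_of_hproj]).

    For a conjugacy class c, the sum of the projections of degrees in c is
    therefore a natural idempotent endomorphism of each object
    ([class_proj_hom]). These idempotents are orthogonal with sum 1, and they
    split in the center ([split_idem]), so every object is the direct sum of
    objects supported on a single class, and there are no nonzero morphisms
    between objects supported on different classes.

    The two copies of Rep(G) inside the center are concentrated in degree 1.
    The objects concentrated in degree 1 form a tensor subcategory
    ([supported_one_tensor_subcat]; for duals, the snake identity shows that
    the degrees of a dual pair are inverse to each other), so the whole acting
    category is concentrated in degree 1, and its action preserves supports.

    For indecomposability, let Z and Z' be nonzero and supported on the same
    class c, and let g be in c. Conjugation being transitive on c, the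
    components Z_g and Z'_g are both nonzero, so there is a nonzero linear map
    phi : Z -> Z' preserving degrees. Then e_a ⊗ z |-> phi(z·a^-1)·a is a
    nonzero morphism k[G] ⊗ Z -> Z' in the center ([transport_hom]); hence Z
    and Z' cannot lie in different summands of a decomposition. *)

Set Implicit Arguments.
Unset Strict Implicit.
Unset Printing Implicit Defensive.

Import GRing.Theory.
Local Open Scope ring_scope.
Local Open Scope cat_scope.

(** * Kronecker products of matrices *)

Section Matrices.
Variable k : fieldType.

Lemma sum_mxvec m n (F : 'I_(m * n) -> k) :
  \sum_x F x = \sum_i \sum_j F (mxvec_index i j).
Proof.
rewrite pair_big (reindex (uncurry (@mxvec_index m n))) /=.
  by apply: eq_bigr => -[i j].
exact: curry_mxvec_bij.
Qed.

Lemma mxvec_ext m n p q (A B : 'M[k]_(m * n, p * q)) :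
  (forall i u j v, A (mxvec_index i u) (mxvec_index j v)
                   = B (mxvec_index i u) (mxvec_index j v)) -> A = B.
Proof.
move=> AB; apply/matrixP=> x y.
by case/mxvec_indexP: x => i u; case/mxvec_indexP: y => j v.
Qed.

Lemma mxvec_index_eq m n (i j : 'I_m) (u v : 'I_n) :
  (mxvec_index i u == mxvec_index j v) = (i == j) && (u == v).
Proof.
by rewrite /mxvec_index (inj_eq (@cast_ord_inj _ _ _)) (inj_eq enum_rank_inj).
Qed.

Lemma scalar_mxvec_entry m n i u j v :
  (1%:M : 'M[k]_(m * n)) (mxvec_index i u) (mxvec_index j v)
  = ((i == j) && (u == v))%:R.
Proof. by rewrite mxE mxvec_index_eq. Qed.

Lemma mul_tprod1M m n p q (B : 'M[k]_(n, p)) (A : 'M[k]_(m * p, q)) i u x :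
  (tprod (1%:M : 'M_m) B *m A) (mxvec_index i u) x
  = \sum_v B u v * A (mxvec_index i v) x.
Proof.
rewrite mxE sum_mxvec (bigD1 i) //= [X in _ + X]big1 ?addr0 => [|j /negPf ji].
  by apply: eq_bigr => v _; rewrite tprod_entry mxE eqxx mul1r.
by apply: big1 => v _; rewrite tprod_entry mxE eq_sym ji !mul0r.
Qed.

Lemma mul_tprodM1 m n p q (B : 'M[k]_(n, p)) (A : 'M[k]_(p * m, q)) i u x :
  (tprod B (1%:M : 'M_m) *m A) (mxvec_index i u) x
  = \sum_j B i j * A (mxvec_index j u) x.
Proof.
rewrite mxE sum_mxvec; apply: eq_bigr => j _.
rewrite (bigD1 u) //= [X in _ + X]big1 ?addr0 => [|v /negPf vu].
  by rewrite tprod_entry mxE eqxx mulr1.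
by rewrite tprod_entry mxE eq_sym vu mulr0 mul0r.
Qed.

Lemma tprod_suml m n q r I (s : seq I) (P : pred I) (F : I -> 'M[k]_(m, n))
    (B : 'M[k]_(q, r)) :
  tprod (\sum_(i <- s | P i) F i) B = \sum_(i <- s | P i) tprod (F i) B.
Proof.
apply: mxvec_ext => i u j v; rewrite tprod_entry !summxE mulr_suml.
by apply: eq_bigr => l _; rewrite tprod_entry.
Qed.

Lemma tprod_muln m n q r (A : 'M[k]_(m, n)) (B : 'M[k]_(q, r)) d :
  tprod (A *+ d) B = tprod A B *+ d.
Proof.
apply: mxvec_ext => i u j v.
by rewrite tprod_entry !mulmxnE tprod_entry mulrnAl.
Qed.

Lemma tprod0l m n q r (A : 'M[k]_(q, r)) : tprod (0 : 'M[k]_(m, n)) A = 0.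
Proof. by rewrite -(mulr0n 0) tprod_muln mulr0n. Qed.

Lemma tprod0r m n q r (A : 'M[k]_(m, n)) : tprod A (0 : 'M[k]_(q, r)) = 0.
Proof. by apply: mxvec_ext => i u j v; rewrite tprod_entry !mxE mulr0. Qed.

Lemma tprodAV m n q m' n' q' (A : 'M[k]_(m, m')) (B : 'M[k]_(n, n'))
    (D : 'M[k]_(q, q')) (e : (m * (n * q) = m * n * q)%N)
    (e' : (m' * (n' * q') = m' * n' * q')%N) :
  tprod A (tprod B D) *m idcast k e' = idcast k e *m tprod (tprod A B) D.
Proof.
rewrite -[RHS]mulmx1 -(idcast_id k (etrans (esym e') e')) -idcast_comp.
rewrite (idcast_irr k (esym e') (esym (mulnA m' n' q'))) mulmxA.
rewrite -(mulmxA _ _ (idcast k (esym _))) tprodA (idcast_irr k e (mulnA m n q)).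
by rewrite !mulmxA idcast_comp idcast_id mul1mx.
Qed.

Lemma idcast_cancel m n q (e : m = n) (A : 'M[k]_(q, m)) :
  A *m idcast k e = 0 -> A = 0.
Proof. by case: n / e; rewrite idcast_id mulmx1. Qed.

(** The right-hand side of the hexagon axiom for a half-braiding, at Y ⊗ W, in
    coordinates: HY and HW are its components at Y and W. *)
Lemma hb_tens_entry m n r
    (HY : 'M[k]_(m * r, r * m)) (HW : 'M[k]_(n * r, r * n))
    (e1 : (m * n * r = m * (n * r))%N) (e2 : (m * (r * n) = m * r * n)%N)
    (e3 : (r * m * n = r * (m * n))%N) y w x x' y' w' :
  (idcast k e1 *m (tprod 1%:M HW *m (idcast k e2 *m
     (tprod HY 1%:M *m idcast k e3))))
    (mxvec_index (mxvec_index y w) x) (mxvec_index x' (mxvec_index y' w'))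
  = \sum_t HW (mxvec_index w x) (mxvec_index t w')
           * HY (mxvec_index y t) (mxvec_index x' y').
Proof.
rewrite mul_idcastE mxvec_indexA mul_tprod1M sum_mxvec.
apply: eq_bigr => t _.
rewrite (bigD1 w') //= [X in _ + X]big1 ?addr0 => [|v /negPf vw].
  congr (_ * _); rewrite mul_idcastE mxvec_indexAV mul_tprodM1 sum_mxvec.
  rewrite (bigD1 x') //= [X in _ + X]big1 ?addr0 => [|u /negPf ux].
    rewrite (bigD1 y') //= [X in _ + X]big1 ?addr0 => [|u /negPf ux].
      rewrite -[idcast k e3]mulmx1 mul_idcastE mxvec_indexA.
      by rewrite scalar_mxvec_entry mxvec_index_eq !eqxx mulr1.
    rewrite -[idcast k e3]mulmx1 mul_idcastE mxvec_indexA.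
    by rewrite scalar_mxvec_entry mxvec_index_eq ux ?andbF mulr0.
  apply: big1 => v _; rewrite -[idcast k e3]mulmx1 mul_idcastE mxvec_indexA.
  by rewrite scalar_mxvec_entry mxvec_index_eq ux ?andbF mulr0.
rewrite mul_idcastE mxvec_indexAV mul_tprodM1 sum_mxvec big1 ?mulr0 // => u _.
apply: big1 => u' _; rewrite -[idcast k e3]mulmx1 mul_idcastE mxvec_indexA.
by rewrite scalar_mxvec_entry mxvec_index_eq vw ?andbF mulr0.
Qed.

(** The half-braiding of a tensor product X ⊗ X' at an object Y, in
    coordinates: H and H' are those of X and X' at Y. *)
Lemma hb_prod_entry m n r (H : 'M[k]_(r * m, m * r)) (H' : 'M[k]_(r * n, n * r))
    (e1 : (r * (m * n) = r * m * n)%N) (e2 : (m * r * n = m * (r * n))%N)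
    (e3 : (m * (n * r) = m * n * r)%N) y x u x' u' y' :
  (idcast k e1 *m (tprod H 1%:M *m (idcast k e2 *m
     (tprod 1%:M H' *m idcast k e3))))
    (mxvec_index y (mxvec_index x u)) (mxvec_index (mxvec_index x' u') y')
  = \sum_t H (mxvec_index y x) (mxvec_index x' t)
           * H' (mxvec_index t u) (mxvec_index u' y').
Proof.
rewrite mul_idcastE mxvec_indexAV mul_tprodM1 sum_mxvec.
rewrite (bigD1 x') //= [X in _ + X]big1 ?addr0 => [|v /negPf vx].
  apply: eq_bigr => t _.
  congr (_ * _); rewrite mul_idcastE mxvec_indexA mul_tprod1M sum_mxvec.
  rewrite (bigD1 u') //= [X in _ + X]big1 ?addr0 => [|v /negPf vu].
    rewrite (bigD1 y') //= [X in _ + X]big1 ?addr0 => [|v /negPf vy].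
      rewrite -[idcast k e3]mulmx1 mul_idcastE mxvec_indexAV.
      by rewrite scalar_mxvec_entry mxvec_index_eq !eqxx mulr1.
    rewrite -[idcast k e3]mulmx1 mul_idcastE mxvec_indexAV.
    by rewrite scalar_mxvec_entry mxvec_index_eq vy ?andbF mulr0.
  apply: big1 => w _; rewrite -[idcast k e3]mulmx1 mul_idcastE mxvec_indexAV.
  by rewrite scalar_mxvec_entry mxvec_index_eq vu ?andbF mulr0.
apply: big1 => t _.
rewrite mul_idcastE mxvec_indexA mul_tprod1M sum_mxvec big1 ?mulr0 // => w _.
apply: big1 => w' _; rewrite -[idcast k e3]mulmx1 mul_idcastE mxvec_indexAV.
by rewrite scalar_mxvec_entry mxvec_index_eq vx ?andbF mulr0.
Qed.

(** If ev and coev satisfy the snake identity, then a linear map P with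
    (P ⊗ 1) ;; ev = 0 is zero: precomposing the snake with P gives both 0
    and P. *)
Lemma snake_proj_left m n (P : 'M[k]_m) (ev : 'M[k]_(m * n, 1))
    (coev : 'M[k]_(1, n * m)) (e : (m * (n * m) = m * n * m)%N)
    (e1 : (m * 1 = m)%N) (e2 : (m = 1 * m)%N) :
  tprod 1%:M coev *m (idcast k e *m tprod ev 1%:M)
  = idcast k e1 *m idcast k e2 ->
  tprod P 1%:M *m ev = 0 -> P = 0.
Proof.
move=> snake Pev.
have P0 : tprod P (1%:M : 'M_1) = 0.
  apply: (@idcast_cancel _ _ _ (etrans e1 e2)).
  rewrite -idcast_comp -snake mulmxA -tprodE mulmx1 mul1mx.
  have -> : tprod P coev = tprod 1%:M coev *m tprod P (tprod 1%:M 1%:M).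
    by rewrite -tprodE tprod1 mul1mx mulmx1.
  rewrite -mulmxA (mulmxA (tprod _ (tprod _ _))) (tprodAV _ _ _ e).
  by rewrite -mulmxA -tprodE Pev tprod0l !mulmx0.
apply/matrixP=> x x'; rewrite -[LHS]mulr1.
have -> : 1 = (1%:M : 'M[k]_1) 0 0 by rewrite mxE.
by rewrite -tprod_entry P0 !mxE.
Qed.

Lemma snake_proj_right m n (P : 'M[k]_m) (ev : 'M[k]_(n * m, 1))
    (coev : 'M[k]_(1, m * n))
    (e1 : (1 * m = m)%N) (e2 : (m = m * 1)%N) :
  tprod coev 1%:M *m (idcast k (esym (mulnA m n m)) *m tprod 1%:M ev)
  = idcast k e1 *m idcast k e2 ->
  tprod 1%:M P *m ev = 0 -> P = 0.
Proof.
move=> snake Pev.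
have P0 : tprod (1%:M : 'M_1) P = 0.
  apply: (@idcast_cancel _ _ _ (etrans e1 e2)).
  rewrite -idcast_comp -snake mulmxA -tprodE mulmx1 mul1mx.
  have -> : tprod coev P = tprod coev 1%:M *m tprod (tprod 1%:M 1%:M) P.
    by rewrite -tprodE tprod1 mul1mx mulmx1.
  rewrite -mulmxA (mulmxA (tprod (tprod _ _) _)) tprodA.
  by rewrite -mulmxA -tprodE Pev tprod0r !mulmx0.
apply/matrixP=> x x'; rewrite -[LHS]mul1r.
have -> : 1 = (1%:M : 'M[k]_1) 0 0 by rewrite mxE.
by rewrite -tprod_entry P0 !mxE.
Qed.

Lemma idempotent_factor n (E : 'M[k]_n) : E *m E = E ->
  exists r (A : 'M[k]_(n, r)) (B : 'M[k]_(r, n)), A *m B = E /\ B *m A = 1%:M.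
Proof.
move=> ee; exists (\rank E), (col_base E), (row_base E).
split; first exact: mulmx_base.
apply: (row_free_inj (row_base_free E)).
apply: (row_full_inj (col_base_full E)).
by rewrite mul1mx -(mulmxA (row_base E)) mulmx_base mulmxA mulmx_base ee.
Qed.

Lemma sandwich_neq0 m n (A : 'M[k]_m) (B : 'M[k]_n) : A != 0 -> B != 0 ->
  exists P : 'M[k]_(m, n), A *m P *m B != 0.
Proof.
move=> /matrix0Pn[i [j Aij]] /matrix0Pn[u [v Buv]]; exists (delta_mx j u).
apply/matrix0Pn; exists i, v.
rewrite -mulmxA mxE (bigD1 j) //= big1 ?addr0 => [|l /negPf lj]; last first.
  rewrite [X in _ * X]mxE big1 ?mulr0 // => w _.
  by rewrite mxE lj mul0r.
rewrite mxE (bigD1 u) //= big1 ?addr0 => [|w /negPf wu]; last first.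
  by rewrite mxE wu andbF mul0r.
by rewrite mxE !eqxx mul1r mulf_neq0.
Qed.

End Matrices.

(** * Conjugacy classes *)

Section ConjugacyClasses.
Variables (gT : finGroupType) (G : {group gT}).

Lemma classes_sub (c : {set gT}) g : c \in classes G -> g \in c -> g \in G.
Proof. by case/imsetP=> x Gx ->; apply: subsetP; apply: class_subG. Qed.

Lemma classes_memJ (c : {set gT}) g h : c \in classes G -> h \in G ->
  (g ^ h \in c)%g = (g \in c).
Proof.
case/imsetP=> x Gx -> Gh; rewrite ![_ \in (x ^: G)%g]class_sym.
by rewrite (class_eqP (memJ_class g Gh)).
Qed.

Lemma classes_trivI (c d : {set gT}) g : c \in classes G -> d \in classes G ->
  g \in c -> g \in d -> c = d.
Proof.
case/imsetP=> x Gx -> /imsetP[y Gy ->].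
by move=> /class_eqP <- /class_eqP <-.
Qed.

Definition one_class : {set gT} := [set 1%g].

Lemma one_class_in : one_class \in classes G.
Proof.
have <- : (1 ^: G)%g = one_class by exact: class1G.
exact: mem_classes.
Qed.

End ConjugacyClasses.

Arguments one_class {gT}.

(** * A criterion for indecomposability *)

(** If any two nonzero objects N, P of S are linked by a nonzero morphism
    X ⊗ N -> P, then S is indecomposable: N and P cannot lie in different
    summands. *)
Lemma indecomposable_of_homs (k : fieldType) (C : moncat k) (M : modcat C)
    (S : module_subcat M) :
  (exists2 N : M, S N & ~ is_zero N) ->
  (forall N P : M, S N -> S P -> ~ is_zero N -> ~ is_zero P ->
     exists (X : C) (f : Hom (act X N) P), f <> 0) ->
  indecomposable (submodcat S).
Proof.
move=> [N0 SN0 nN0] homS; split; first by exists (exist _ N0 SN0).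
move=> D [_ D0].
have [H|[[N SN] [DN nN]]] : (forall N, D true N -> is_zero N)
    \/ (exists N, D true N /\ ~ is_zero N).
  case: (pselect (exists N, D true N /\ ~ is_zero N)) => H; first by right.
  by left=> N DN; apply: contrapT => nN; apply: H; exists N.
  by exists true.
exists false => -[P SP] DP; apply: contrapT => nP.
have [X [f nf]] := homS N P SN SP nN nP.
exact: nf (D0 true false isT _ _ (ms_act X DN) DP f).
Qed.

(** * From gradings to half-braidings *)

Section CenterOfRep.
Variables (k : fieldType) (gT : finGroupType) (G : {group gT}).
Local Notation rep := (representation k G).
Local Notation ix g := (gring_index G g%g).
Local Notation br := (Rep_braiding k G).

(** The regular representation k[G], where h sends e_a to e_(a * h); the index
    of the basis vector e_a is [ix a]. *)
Definition regrep : rep := Representation (regular_repr k G).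

Lemma regrep_entry g (x : gT) i : x \in G ->
  regrep g (ix x) i = (i == ix (x * g))%:R.
Proof. by move=> Gx; rewrite /= !mxE eqxx gring_indexK. Qed.

Lemma sum_regrep (F : 'I_#|G| -> k) : \sum_i F i = \sum_(g in G) F (ix g).
Proof.
rewrite [RHS]big_enum_val; apply: eq_bigr => i _.
by rewrite gring_valK.
Qed.

Lemma ix_eq g h : g \in G -> h \in G -> (ix g == ix h) = (g == h).
Proof.
by move=> Gg Gh; rewrite -(inj_eq enum_val_inj) !gring_indexK.
Qed.

(** A G-grading of X compatible with the action of G, given by the projections
    p g on the homogeneous components. Since G acts on the right, h maps the
    component of degree g to that of degree g ^ h. Values of p outside of G
    are irrelevant. *)
Record grading (X : rep) (p : gT -> 'M[k]_(rdegree X)) : Prop := Grading {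
  gr_orth : forall g h, g \in G -> h \in G -> p g *m p h = p g *+ (g == h);
  gr_sum : \sum_(g in G) p g = 1%:M;
  gr_conj : forall g h, g \in G -> h \in G ->
    X h *m p (g ^ h)%g = p g *m X h }.
Arguments grading X p : clear implicits.

(** The matrix of y ⊗ x |-> \sum_(g in G) p g x ⊗ y·g. *)
Definition crossmx n (p : gT -> 'M[k]_n) (Y : rep) :
    'M[k]_(rdegree Y * n, n * rdegree Y) :=
  flip k (rdegree Y) n *m \sum_(g in G) tprod (p g) (Y g).

Lemma crossmxE n (p : gT -> 'M[k]_n) (Y : rep) y x x' y' :
  crossmx p Y (mxvec_index y x) (mxvec_index x' y')
  = \sum_(g in G) p g x x' * Y g y y'.
Proof.
rewrite mul_flip summxE; apply: eq_bigr => g _; exact: tprod_entry.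
Qed.

Lemma crossmx_reg n (p : gT -> 'M[k]_n) x x' g : g \in G ->
  crossmx p regrep (mxvec_index (ix 1) x) (mxvec_index x' (ix g)) = p g x x'.
Proof.
move=> Gg; rewrite crossmxE (bigD1 g) //= [X in _ + X]big1 ?addr0 => [|h].
  by rewrite regrep_entry // mul1g eqxx mulr1.
case/andP=> Gh /negPf gh.
by rewrite regrep_entry // mul1g ix_eq // eq_sym gh mulr0.
Qed.

Lemma crossmx_tens_entry n (p : gT -> 'M[k]_n) (Y W : rep)
    (m := rdegree Y) (r := rdegree W)
    (e1 : (m * r * n = m * (r * n))%N) (e2 : (m * (n * r) = m * n * r)%N)
    (e3 : (n * m * r = n * (m * r))%N) y w x x' y' w' :
  (idcast k e1 *m (tprod 1%:M (crossmx p W) *m (idcast k e2 *m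
     (tprod (crossmx p Y) 1%:M *m idcast k e3))))
    (mxvec_index (mxvec_index y w) x) (mxvec_index x' (mxvec_index y' w'))
  = \sum_(g in G) \sum_(h in G) (p h *m p g) x x' * (Y g y y' * W h w w').
Proof.
rewrite hb_tens_entry.
under eq_bigr do rewrite !crossmxE mulr_suml.
rewrite exchange_big [RHS]exchange_big /=; apply: eq_bigr => h _.
under eq_bigr do rewrite mulr_sumr.
rewrite exchange_big /=; apply: eq_bigr => g _.
rewrite mxE mulr_suml; apply: eq_bigr => t _.
by rewrite mulrACA [W h _ _ * _]mulrC.
Qed.

Section YetterDrinfeld.
Variables (X : rep) (p : gT -> 'M[k]_(rdegree X)).
Hypothesis gp : grading X p.

(** The inverse of [crossmx p Y]: x ⊗ y |-> \sum_(g in G) y·g^-1 ⊗ p g x. *)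
Definition crossmxV (Y : rep) :
    'M[k]_(rdegree X * rdegree Y, rdegree Y * rdegree X) :=
  (\sum_(g in G) tprod (p g) (Y g^-1%g)) *m flip k (rdegree X) (rdegree Y).

Lemma crossmxK Y : crossmx p Y *m crossmxV Y = 1%:M.
Proof.
rewrite /crossmx /crossmxV mulmxA -(mulmxA (flip _ _ _)).
suff -> : (\sum_(g in G) tprod (p g) (Y g)) *m
    (\sum_(g in G) tprod (p g) (Y g^-1%g)) = 1%:M by rewrite mulmx1 flipK.
rewrite mulmx_suml -tprod1 -(gr_sum gp) tprod_suml; apply: eq_bigr => g Gg.
rewrite mulmx_sumr (bigD1 g) //= [X in _ + X]big1 ?addr0 => [|h].
  by rewrite -tprodE (gr_orth gp) // eqxx -repr_mxM ?groupV // mulgV repr_mx1.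
case/andP=> Gh /negPf hg.
by rewrite -tprodE (gr_orth gp) // eq_sym hg mulr0n -(mulr0n 0) tprod_muln.
Qed.

Lemma crossmxVK Y : crossmxV Y *m crossmx p Y = 1%:M.
Proof.
rewrite /crossmx /crossmxV -mulmxA (mulmxA (flip _ _ _)) flipK mul1mx.
rewrite mulmx_suml -tprod1 -(gr_sum gp) tprod_suml; apply: eq_bigr => g Gg.
rewrite mulmx_sumr (bigD1 g) //= [X in _ + X]big1 ?addr0 => [|h].
  by rewrite -tprodE (gr_orth gp) // eqxx -repr_mxM ?groupV // mulVg repr_mx1.
case/andP=> Gh /negPf hg.
by rewrite -tprodE (gr_orth gp) // eq_sym hg mulr0n -(mulr0n 0) tprod_muln.
Qed.

Lemma crossmx_intertwines (Y : rep) :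
  @intertwines k gT G (rep_tens Y X) (rep_tens X Y) (crossmx p Y).
Proof.
move=> h Gh /=; rewrite /crossmx mulmxA flip_nat -!mulmxA; congr (_ *m _).
rewrite mulmx_suml mulmx_sumr (reindex_inj (conjg_inj h)) /=.
under eq_bigl => g do rewrite groupJr //.
apply: eq_bigr => g Gg; rewrite -!tprodE (gr_conj gp) // -!repr_mxM ?groupJ //.
by rewrite -conjgC.
Qed.

Definition yd_hb (Y : Rep k G) :
    @Hom k (Rep k G) (Y ⊗ (X : Rep k G)) ((X : Rep k G) ⊗ Y) :=
  rhom (@crossmx_intertwines Y).

Fact crossmxV_intertwines (Y : rep) :
  @intertwines k gT G (rep_tens X Y) (rep_tens Y X) (crossmxV Y).
Proof.
move=> h Gh /=; rewrite -[LHS]mul1mx -(crossmxVK Y).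
rewrite -(mulmxA (crossmxV Y)); congr (_ *m _).
have /= YX := @crossmx_intertwines Y h Gh.
by rewrite mulmxA -YX -(mulmxA (tprod _ _)) crossmxK mulmx1.
Qed.

Fact yd_hb_iso Y : is_iso (yd_hb Y).
Proof.
exists (rhom (@crossmxV_intertwines Y)).
by split; apply/val_inj; [exact: crossmxK | exact: crossmxVK].
Qed.

Fact yd_hb_nat (Y Y' : Rep k G) (f : Hom Y Y') :
  f ⊗₁ idm (X : Rep k G) ;; yd_hb Y' = yd_hb Y ;; idm (X : Rep k G) ⊗₁ f.
Proof.
apply/val_inj; rewrite /= /crossmx mulmxA flip_nat -!mulmxA; congr (_ *m _).
rewrite mulmx_suml mulmx_sumr; apply: eq_bigr => g Gg.
by rewrite -!tprodE mul1mx mulmx1 (rhomP f).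
Qed.

Fact yd_hb_tens (Y W : Rep k G) : yd_hb (Y ⊗ W) =
  asso Y W (X : Rep k G) ;; idm Y ⊗₁ yd_hb W ;; assoV Y (X : Rep k G) W ;;
  yd_hb Y ⊗₁ idm W ;; asso (X : Rep k G) Y W.
Proof.
apply/val_inj/mxvec_ext => a x x' b.
case/mxvec_indexP: a => y w; case/mxvec_indexP: b => y' w'.
rewrite [RHS]crossmx_tens_entry [LHS]crossmxE.
apply: eq_bigr => g Gg; rewrite (bigD1 g) //= [X in _ + X]big1 ?addr0 => [|h].
  by rewrite (gr_orth gp) // eqxx tprod_entry.
by case/andP=> Gh /negPf hg; rewrite (gr_orth gp) // hg mxE mul0r.
Qed.

(** The object of the center defined by a grading. *)
Definition yd_object : center (Rep k G) :=
  CenterOb yd_hb_iso yd_hb_nat yd_hb_tens.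

End YetterDrinfeld.

(** * From half-braidings to gradings *)

Implicit Types Z : center (Rep k G).

(** The underlying representation of an object of the center. *)
Definition urep Z : rep := cob Z.

(** The matrix of the half-braiding of Z at Y. *)
Definition hbM Z (Y : rep) :
    'M[k]_(rdegree Y * rdegree (urep Z), rdegree (urep Z) * rdegree Y) :=
  subspace_val (@hb k (Rep k G) Z Y).

(** The matrix of a morphism of the center. *)
Definition homM Z Z' (f : Hom Z Z') :
    'M[k]_(rdegree (urep Z), rdegree (urep Z')) :=
  subspace_val (subspace_val f).

Lemma homM_inj Z Z' : injective (@homM Z Z').
Proof. by move=> f g fg; do 2!apply: val_inj. Qed.

Lemma homM_lin Z Z' a (f g : Hom Z Z') :
  homM (a *: f + g) = a *: homM f + homM g.
Proof.
rewrite /homM.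
have -> := @subspace_valL k _ (hb_compat_space Z Z') a f g.
exact: (@subspace_valL k _ (intertwines_space (urep Z) (urep Z')) a).
Qed.

Lemma homM0 Z Z' : homM (0 : Hom Z Z') = 0.
Proof.
have := homM_lin (-1) (0 : Hom Z Z') 0.
by rewrite scaler0 addr0 scaleN1r addNr.
Qed.

Lemma homM_sum Z Z' (I : finType) (f : I -> Hom Z Z') :
  homM (\sum_i f i) = \sum_i homM (f i).
Proof.
apply: (big_morph (fun h : Hom Z Z' => homM h)) => [u v|]; last exact: homM0.
by rewrite -[u in LHS]scale1r homM_lin scale1r.
Qed.

Lemma homM_intertwines Z Z' (f : Hom Z Z') :
  @intertwines k gT G (urep Z) (urep Z') (homM f).
Proof. exact: rhomP. Qed.

Lemma is_zeroP Z : is_zero Z <-> (1%:M : 'M[k]_(rdegree (urep Z))) = 0.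
Proof.
split=> [/(congr1 (fun f : Hom Z Z => homM f))|E]; first by rewrite homM0.
by apply: homM_inj; rewrite homM0.
Qed.

Lemma hbM_nat Z (Y Y' : rep) f : @intertwines k gT G Y Y' f ->
  tprod f 1%:M *m hbM Z Y' = hbM Z Y *m tprod 1%:M f.
Proof.
by move=> fP; have /(congr1 val) := @hb_nat k (Rep k G) Z Y Y' (rhom fP).
Qed.

(** The projection of Z on its component of degree g: the coefficient of e_g in
    the half-braiding applied to e_1 ⊗ x, for the regular representation. *)
Definition hproj Z g : 'M[k]_(rdegree (urep Z)) :=
  \matrix_(x, x') hbM Z regrep (mxvec_index (ix 1) x) (mxvec_index x' (ix g)).

(** The morphism k[G] -> Y sending e_a to y·a, for a basis vector y of Y. *)
Lemma regrep_to_intertwines (Y : rep) y :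
  @intertwines k gT G regrep Y (\matrix_i row y (Y (enum_val i))).
Proof.
move=> h Gh; apply/row_matrixP=> i.
rewrite row_mul /= rowK -rowE rowK row_mul rowK -row_mul.
by rewrite gring_indexK ?groupM ?enum_valP // repr_mxM ?enum_valP.
Qed.

(** The half-braiding of Z is determined by the projections, by naturality with
    respect to the morphisms k[G] -> Y. *)
Lemma hbME Z Y : hbM Z Y = crossmx (hproj Z) Y.
Proof.
apply: mxvec_ext => y x x' y'; rewrite crossmxE.
have /(congr1 (fun A : 'M__ => A (mxvec_index (ix 1) x) (mxvec_index x' y'))) :=
  hbM_nat Z (@regrep_to_intertwines Y y).
rewrite mul_tprodM1 (bigD1 y) //= [X in _ + X]big1 ?addr0 => [|j /negPf jy].
  rewrite !mxE gring_indexK // repr_mx1 mxE eqxx mul1r => ->.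
  rewrite sum_mxvec (bigD1 x') //= [X in _ + X]big1 ?addr0 => [|j /negPf jx].
    rewrite sum_regrep; apply: eq_bigr => g Gg.
    by rewrite tprod_entry !mxE eqxx mul1r gring_indexK.
  by apply: big1 => u _; rewrite tprod_entry !mxE jx mul0r mulr0.
by rewrite !mxE gring_indexK // repr_mx1 mxE eq_sym jy mul0r.
Qed.

Lemma hproj_unique Z (p : gT -> 'M[k]_(rdegree (urep Z))) g : g \in G ->
  hbM Z regrep = crossmx p regrep -> hproj Z g = p g.
Proof.
by move=> Gg E; apply/matrixP=> x x'; rewrite mxE E crossmx_reg.
Qed.

Lemma hbM_tens Z (Y W : rep) : hbM Z (rep_tens Y W) =
  idcast k (esym (mulnA _ _ _)) *m (tprod 1%:M (hbM Z W) *m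
    (idcast k (esym (esym (mulnA _ _ _))) *m
      (tprod (hbM Z Y) 1%:M *m idcast k (esym (mulnA _ _ _))))).
Proof. by have /(congr1 val) := @hb_tens k (Rep k G) Z Y W. Qed.

(** Comparison of the coefficients of e_h ⊗ e_g in the hexagon axiom for
    k[G] ⊗ k[G], evaluated at e_1 ⊗ e_1. *)
Lemma hproj_orth Z g h : g \in G -> h \in G ->
  hproj Z g *m hproj Z h = hproj Z g *+ (g == h).
Proof.
move=> Gg Gh; apply/matrixP=> x x'; symmetry.
have /(congr1 (fun A : 'M__ => A (mxvec_index (mxvec_index (ix 1) (ix 1)) x)
  (mxvec_index x' (mxvec_index (ix h) (ix g))))) := @hbM_tens Z regrep regrep.
rewrite !hbME [RHS](@crossmx_tens_entry _ (hproj Z) regrep regrep).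
rewrite [LHS]crossmxE.
under eq_bigr => u Gu do rewrite tprod_entry !regrep_entry // mul1g !ix_eq //.
under [RHS]eq_bigr => u Gu do under eq_bigr => v Gv do
  rewrite !regrep_entry // !mul1g !ix_eq //.
rewrite (bigD1 h) //= [X in _ + X]big1 ?addr0 => [|u /andP[_ /negPf uh]].
  rewrite [RHS](bigD1 h) //= [X in _ + X]big1 ?addr0 => [|u /andP[_ /negPf uh]].
    rewrite [RHS](bigD1 g) //= [X in _ + X]big1 ?addr0 => [|u]; last first.
      by case/andP=> _ /negPf ug; rewrite (eq_sym g) ug !mulr0.
    rewrite !eqxx mul1r !mulr1 => <-; rewrite mulmxnE.
    by case: eqP => [->|_]; rewrite ?mulr1 ?mulr0.
  by rewrite big1 // => v _; rewrite (eq_sym h) uh mul0r mulr0.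
by rewrite (eq_sym h) uh mul0r mulr0.
Qed.

(** The sum of the projections is idempotent, and it is invertible since it is
    the half-braiding of Z with the unit object. *)
Lemma hproj_sum Z : \sum_(g in G) hproj Z g = 1%:M.
Proof.
set s := \sum_(g in G) hproj Z g.
have ss : s *m s = s.
  rewrite mulmx_suml; apply: eq_bigr => g Gg; rewrite mulmx_sumr (bigD1 g) //=.
  rewrite hproj_orth // eqxx big1 ?addr0 // => h /andP[Gh /negPf hg].
  by rewrite hproj_orth // eq_sym hg.
have [b [/(congr1 val) /= + _]] := @hb_iso k (Rep k G) Z (rep_one k G).
set B : 'M_(_, _) := subspace_val b => HB.
have {}HB : hbM Z (rep_one k G) *m B = 1%:M by [].
suff sB : s *m (\matrix_(x, x') B (mxvec_index x 0) (mxvec_index 0 x')) = 1%:M.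
  by rewrite -[LHS]mulmx1 -sB mulmxA ss.
apply/matrixP=> x x'; rewrite [LHS]mxE [RHS]mxE.
move/matrixP: HB => /(_ (mxvec_index 0 x) (mxvec_index 0 x')).
rewrite scalar_mxvec_entry eqxx /= => <-.
rewrite [RHS]mxE [RHS]sum_mxvec; apply: eq_bigr => u _.
rewrite big_ord1 mxE hbME; congr (_ * _).
rewrite summxE [RHS](@crossmxE _ _ (rep_one k G)).
by apply: eq_bigr => g Gg; rewrite [X in _ * X]mxE eqxx mulr1.
Qed.

(** This is the equivariance of the half-braiding of Z with k[G]. *)
Lemma hproj_conj Z g h : g \in G -> h \in G ->
  urep Z h *m hproj Z (g ^ h)%g = hproj Z g *m urep Z h.
Proof.
move=> Gg Gh.
have : tprod (regrep h) (urep Z h) *m hbM Z regrep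
    = hbM Z regrep *m tprod (urep Z h) (regrep h).
  exact: (rhomP (@hb k (Rep k G) Z regrep)) h Gh.
rewrite hbME /crossmx mulmxA flip_nat -!mulmxA.
move/(congr1 (mulmx (flip k _ _))); rewrite !mulmxA flipK !mul1mx.
move/matrixP=> E; apply/matrixP=> x x'.
move: (E (mxvec_index x (ix 1)) (mxvec_index x' (ix (g * h)))).
rewrite mulmx_suml mulmx_sumr !summxE.
have dl u : u \in G ->
     (tprod (urep Z h) (regrep h) *m tprod (hproj Z u) (regrep u))
     (mxvec_index x (ix 1)) (mxvec_index x' (ix (g * h)))
   = (urep Z h *m hproj Z u) x x' * (u == g ^ h)%g%:R.
  move=> Gu; rewrite -tprodE -repr_mxM // tprod_entry regrep_entry // mul1g.
  by rewrite ix_eq ?groupM // conjgC (inj_eq (mulgI h)) eq_sym.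
have dr u : u \in G ->
     (tprod (hproj Z u) (regrep u) *m tprod (urep Z h) (regrep h))
     (mxvec_index x (ix 1)) (mxvec_index x' (ix (g * h)))
   = (hproj Z u *m urep Z h) x x' * (u == g)%:R.
  move=> Gu; rewrite -tprodE -repr_mxM // tprod_entry regrep_entry // mul1g.
  by rewrite ix_eq ?groupM // (inj_eq (mulIg h)) eq_sym.
rewrite (eq_bigr _ dl) [RHS](eq_bigr _ dr).
rewrite (bigD1 (g ^ h)%g) ?groupJ //= eqxx mulr1 big1 ?addr0; last first.
  by move=> u /andP[_ /negPf->]; rewrite mulr0.
rewrite (bigD1 g) //= eqxx mulr1 big1 ?addr0 //.
by move=> u /andP[_ /negPf->]; rewrite mulr0.
Qed.

Lemma hproj_grading Z : grading (urep Z) (hproj Z).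
Proof.
by split=> *; [exact: hproj_orth | exact: hproj_sum | exact: hproj_conj].
Qed.

Lemma hom_hproj Z Z' (f : Hom Z Z') g : g \in G ->
  hproj Z g *m homM f = homM f *m hproj Z' g.
Proof.
move=> Gg.
have : tprod 1%:M (homM f) *m hbM Z' regrep
    = hbM Z regrep *m tprod (homM f) 1%:M.
  by have /(congr1 val) := chomP f regrep.
rewrite !hbME /crossmx mulmxA flip_nat -!mulmxA.
move/(congr1 (mulmx (flip k _ _))); rewrite !mulmxA flipK !mul1mx.
move/matrixP=> E; apply/matrixP=> x x'.
move: (E (mxvec_index x (ix 1)) (mxvec_index x' (ix g))).
rewrite mulmx_suml mulmx_sumr !summxE.
under eq_bigr => u Gu do
  rewrite -tprodE mul1mx tprod_entry regrep_entry // mul1g ix_eq // eq_sym.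
under [RHS]eq_bigr => u Gu do
  rewrite -tprodE mulmx1 tprod_entry regrep_entry // mul1g ix_eq // eq_sym.
rewrite (bigD1 g) //= eqxx mulr1 big1 ?addr0; last first.
  by move=> u /andP[_ /negPf->]; rewrite mulr0.
rewrite (bigD1 g) //= eqxx mulr1 big1 ?addr0 //.
by move=> u /andP[_ /negPf->]; rewrite mulr0.
Qed.

(** Intertwiners that preserve degrees are morphisms of the center. *)
Lemma hom_of_hproj Z Z' (f : 'M[k]_(rdegree (urep Z), rdegree (urep Z'))) :
  @intertwines k gT G (urep Z) (urep Z') f ->
  (forall g, g \in G -> hproj Z g *m f = f *m hproj Z' g) ->
  exists F : Hom Z Z', homM F = f.
Proof.
move=> fi fp.
have fc : hb_compat (rhom fi : @Hom k (Rep k G) (cob Z) (cob Z')).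
  move=> Y; apply: val_inj.
  change (tprod 1%:M f *m hbM Z' Y = hbM Z Y *m tprod f 1%:M).
  rewrite !hbME /crossmx mulmxA flip_nat -!mulmxA; congr (_ *m _).
  rewrite mulmx_suml mulmx_sumr; apply: eq_bigr => g Gg.
  by rewrite -!tprodE mul1mx mulmx1 fp.
by exists (chom fc).
Qed.

Lemma hproj_yd_object (X : rep) (p : gT -> 'M[k]_(rdegree X))
    (gp : grading X p) g : g \in G -> hproj (yd_object gp) g = p g.
Proof. by move=> Gg; apply: (@hproj_unique (yd_object gp)). Qed.

(** The degree of a tensor product of homogeneous vectors is the product of
    their degrees. *)
Lemma hproj_tens Z Z' g : g \in G ->
  hproj (Z ⊗ Z') g = \sum_(a in G) tprod (hproj Z a) (hproj Z' (a^-1 * g)%g).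
Proof.
move=> Gg; apply: mxvec_ext => x u x' u'; rewrite summxE mxE.
have -> : hbM (Z ⊗ Z') regrep =
  idcast k (esym (esym (mulnA _ _ _))) *m (tprod (hbM Z regrep) 1%:M *m
    (idcast k (esym (mulnA _ _ _)) *m
      (tprod 1%:M (hbM Z' regrep) *m
        idcast k (esym (esym (mulnA _ _ _)))))) by [].
rewrite !hbME hb_prod_entry sum_regrep.
under eq_bigr => h Gh do rewrite crossmx_reg //.
apply: eq_bigr => a Ga; rewrite tprod_entry; congr (_ * _).
rewrite (crossmxE _ (Y := regrep)) (bigD1 (a^-1 * g)%g) ?groupM ?groupV //=.
rewrite regrep_entry // mulKVg eqxx mulr1 big1 ?addr0 // => b /andP[Gb bg].
rewrite regrep_entry // ix_eq ?groupM //.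
case: eqP => [gab|]; last by rewrite mulr0.
by rewrite gab mulKg eqxx in bg.
Qed.

Lemma hproj_one g : g \in G ->
  hproj (𝟙 : center (Rep k G)) g = (g == 1%g)%:R%:M.
Proof.
move=> Gg; apply/matrixP=> x x'; rewrite mxE.
have -> : hbM (𝟙 : center (Rep k G)) regrep =
  idcast k (muln1 _) *m idcast k (esym (mul1n _)) by [].
rewrite mul_idcastE -[idcast k (esym _)]mulmx1 mul_idcastE.
rewrite !mxE !ord1 eqxx mulr1n.
have -> : cast_ord (esym (mul1n #|G|)) (cast_ord (muln1 #|G|)
   (mxvec_index (ix 1) (0 : 'I_1))) = mxvec_index (0 : 'I_1) (ix 1).
  by apply: ord_inj; rewrite 2!ord_cast !mxvec_index_val muln1 addn0 mul0n.
by rewrite mxvec_index_eq eqxx /= ix_eq // eq_sym.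
Qed.

Lemma hproj_one0 g : g \in G -> g != 1%g ->
  hproj (𝟙 : center (Rep k G)) g = 0.
Proof. by move=> Gg /negPf g1; rewrite hproj_one // g1 raddf0. Qed.

(** An object whose half-braiding is the flip is concentrated in degree 1. *)
Lemma hproj_flip Z g : hbM Z regrep = flip k _ _ -> g \in G ->
  hproj Z g = (g == 1%g)%:R%:M.
Proof.
move=> E Gg; apply/matrixP=> x x'.
by rewrite mxE E flipE ix_eq // [RHS]mxE -mulrnA mulnb (eq_sym 1%g).
Qed.

(** * Supports *)

(** The projection on the sum of the components whose degree is in c. *)
Definition class_proj Z (c : {set gT}) : 'M[k]_(rdegree (urep Z)) :=
  \sum_(g in c) hproj Z g.

Lemma hproj_class_proj Z c g : c \in classes G -> g \in G ->
  hproj Z g *m class_proj Z c = hproj Z g *+ (g \in c).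
Proof.
move=> Cc Gg; rewrite mulmx_sumr; case: (boolP (g \in c)) => [cg|/negP cg].
  rewrite (bigD1 g) //= hproj_orth // eqxx.
  rewrite big1 ?addr0 // => h /andP[ch /negPf hg].
  by rewrite hproj_orth ?(classes_sub Cc ch) // eq_sym hg.
apply: big1 => h ch; rewrite hproj_orth ?(classes_sub Cc ch) //.
by case: eqP => [E|//]; rewrite E in cg.
Qed.

Lemma class_proj_orth Z c d : c \in classes G -> d \in classes G ->
  class_proj Z c *m class_proj Z d = class_proj Z c *+ (c == d).
Proof.
move=> Cc Cd; rewrite mulmx_suml -sumrMnl; apply: eq_bigr => g cg.
rewrite hproj_class_proj ?(classes_sub Cc) //; congr (_ *+ nat_of_bool _).
by apply/idP/eqP => [dg|<- //]; exact: classes_trivI Cc Cd cg dg.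
Qed.

Lemma class_proj_sum Z : \sum_(c in classes G) class_proj Z c = 1%:M.
Proof.
have /and3P[/eqP cG tI _] := classes_partition G.
by rewrite -(hproj_sum Z) -[in RHS]cG big_trivIset.
Qed.

Lemma hom_class_proj Z Z' (f : Hom Z Z') c : c \in classes G ->
  class_proj Z c *m homM f = homM f *m class_proj Z' c.
Proof.
move=> Cc; rewrite mulmx_suml mulmx_sumr; apply: eq_bigr => g cg.
by rewrite hom_hproj ?(classes_sub Cc).
Qed.

Lemma class_proj_hom Z c : c \in classes G ->
  exists F : Hom Z Z, homM F = class_proj Z c.
Proof.
move=> Cc; apply: hom_of_hproj => [h Gh|g Gg].
  rewrite mulmx_suml mulmx_sumr (reindex_inj (conjg_inj h)) /=.
  apply: eq_big => g; first exact: (classes_memJ _ Cc Gh).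
  rewrite (classes_memJ _ Cc Gh) => cg.
  by rewrite hproj_conj // (classes_sub Cc cg).
rewrite hproj_class_proj // mulmx_suml; symmetry.
case: (boolP (g \in c)) => [cg|/negP cg].
  rewrite (bigD1 g) //= hproj_orth // eqxx.
  rewrite big1 ?addr0 // => h /andP[ch /negPf hg].
  by rewrite hproj_orth ?(classes_sub Cc ch) // hg.
apply: big1 => h ch; rewrite hproj_orth ?(classes_sub Cc ch) //.
by case: eqP => [E|//]; rewrite -E in cg.
Qed.

(** Z is supported on c if all its components of degree outside of c vanish. *)
Definition supported (c : {set gT}) Z : Prop := class_proj Z c = 1%:M.

(** Closure under subquotients uses neither kernels nor cokernels: the
    projections are natural, so one that is the identity on the target of a
    monomorphism, or on the source of an epimorphism, is so on the other side. *)
Lemma supported_subquotient c : c \in classes G ->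
  subquotient_closed (supported c).
Proof.
move=> Cc; split.
- move=> I X S [i [p [_ _ ip]]] suppX; rewrite /supported -[LHS]mulmx1.
  have {}ip : \sum_j (homM (p j) *m homM (i j)) = 1%:M.
    have /(congr1 (fun f : Hom S S => homM f)) := ip.
    by rewrite homM_sum => ->.
  rewrite -[in LHS]ip -[RHS]ip mulmx_sumr; apply: eq_bigr => j _.
  by rewrite mulmxA hom_class_proj // suppX mulmx1.
- move=> X Y f mf suppY; have [F HF] := class_proj_hom X Cc.
  rewrite /supported -HF (mf X F (idm X)) //.
  apply: homM_inj; rewrite comp1m.
  change (homM F *m homM f = homM f).
  by rewrite HF hom_class_proj // suppY mulmx1.
- move=> X Y f ef suppX; have [F HF] := class_proj_hom Y Cc.
  rewrite /supported -HF (ef Y F (idm Y)) //.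
  apply: homM_inj; rewrite compm1.
  change (homM f *m homM F = homM f).
  by rewrite HF -hom_class_proj // suppX mul1mx.
Qed.

Lemma supported_hom0 c d Z Z' (f : Hom Z Z') :
  c \in classes G -> d \in classes G -> c != d ->
  supported c Z -> supported d Z' -> f = 0.
Proof.
move=> Cc Cd cd Zc Z'd; apply: homM_inj; rewrite homM0.
rewrite -[LHS]mulmx1 -Z'd -[homM f]mul1mx -Zc -mulmxA -hom_class_proj // mulmxA.
by rewrite class_proj_orth // (negPf cd) mulr0n mul0mx.
Qed.

(** * Objects concentrated in degree 1 *)

Lemma supported_oneP Z : supported one_class Z <->
  forall g, g \in G -> hproj Z g = (g == 1%g)%:R%:M.
Proof.
rewrite /supported /class_proj big_set1; split=> [s g Gg|->]; rewrite ?eqxx //.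
have [->|g1] := eqVneq g 1%g; first exact: s.
rewrite -[LHS]mul1mx -s hproj_orth ?group1 // eq_sym (negPf g1) mulr0n.
by rewrite raddf0.
Qed.

Lemma supported_one_of_hproj0 Z :
  (forall g, g \in G -> g != 1%g -> hproj Z g = 0) -> supported one_class Z.
Proof.
move=> Z0; rewrite /supported /class_proj big_set1 -(hproj_sum Z).
rewrite [RHS](bigD1 1%g) //=.
by rewrite big1 ?addr0 // => g /andP[Gg g1]; apply: Z0.
Qed.

Lemma supported_one_flip Z : hbM Z regrep = flip k _ _ -> supported one_class Z.
Proof. by move=> E; apply/supported_oneP => g; apply: hproj_flip. Qed.

Lemma hproj_tens_onel Z Z' g : supported one_class Z -> g \in G ->
  hproj (Z ⊗ Z') g = tprod 1%:M (hproj Z' g).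
Proof.
move=> /supported_oneP Z1 Gg; rewrite hproj_tens // (bigD1 1%g) //=.
rewrite Z1 // eqxx invg1 mul1g big1 ?addr0 // => a /andP[Ga /negPf a1].
by rewrite Z1 // a1 raddf0 tprod0l.
Qed.

Lemma hproj_tens_oner Z Z' g : supported one_class Z' -> g \in G ->
  hproj (Z ⊗ Z') g = tprod (hproj Z g) 1%:M.
Proof.
move=> /supported_oneP Z1 Gg; rewrite hproj_tens // (bigD1 g) //=.
rewrite Z1 ?mulVg // eqxx big1 ?addr0 // => a /andP[Ga ag].
rewrite Z1 ?groupM ?groupV // -eq_mulVg1 (negPf ag) raddf0; exact: tprod0r.
Qed.

Lemma supported_tens c Z Z' :
  c \in classes G -> supported one_class Z -> supported c Z' ->
  supported c (Z ⊗ Z').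
Proof.
move=> Cc Z1; rewrite /supported /class_proj => Z'c.
under eq_bigr => g cg do rewrite (hproj_tens_onel _ Z1 (classes_sub Cc cg)).
rewrite -tprod1 -Z'c; apply: mxvec_ext => i u j v.
rewrite tprod_entry !summxE mulr_sumr.
by apply: eq_bigr => g _; rewrite tprod_entry.
Qed.

(** Since ev preserves degrees and Z is in degree 1, the component of degree
    g <> 1 of the dual Z' is in the kernel of the pairing. *)
Lemma dual_supported_one_left Z Z' :
  is_dual Z Z' -> supported one_class Z -> supported one_class Z'.
Proof.
case=> ev [coev [_ /(congr1 (fun f : Hom (Z' ⊗ 𝟙) (𝟙 ⊗ Z') => homM f))]] snake Z1.
apply: supported_one_of_hproj0 => g Gg g1; apply: snake_proj_left snake _.
by have := hom_hproj ev Gg; rewrite hproj_tens_oner // hproj_one0 // mulmx0.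
Qed.

Lemma dual_supported_one_right Z Z' :
  is_dual Z Z' -> supported one_class Z' -> supported one_class Z.
Proof.
case=> ev [coev [/(congr1 (fun f : Hom (𝟙 ⊗ Z) (Z ⊗ 𝟙) => homM f)) snake _]] Z1.
apply: supported_one_of_hproj0 => g Gg g1; apply: snake_proj_right snake _.
by have := hom_hproj ev Gg; rewrite hproj_tens_onel // hproj_one0 // mulmx0.
Qed.

Lemma supported_one_tensor_subcat : tensor_subcat (supported one_class).
Proof.
split.
- exact: supported_subquotient (one_class_in G).
- apply: supported_one_of_hproj0 => g; exact: hproj_one0.
- by move=> Z Z'; apply: supported_tens (one_class_in G).
- move=> Z Z' d.
  by split; [exact: dual_supported_one_left | exact: dual_supported_one_right].
Qed.

Lemma tilde_supported_one Z : tilde_mem br Z -> supported one_class Z.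
Proof.
apply; first exact: supported_one_tensor_subcat.
by move=> _ [X [->|->]]; apply: supported_one_flip.
Qed.

Lemma tilde_mem_br (X : Rep k G) : tilde_mem br (center_br br X).
Proof. by move=> P _; apply; exists X; left. Qed.

(** * Decomposition of an object along the conjugacy classes *)

(** Idempotents split in the center: the grading and the action of G restrict
    to the image. *)
Lemma split_idem Z (e : Hom Z Z) : e ;; e = e ->
  exists W (i : Hom W Z) (p : Hom Z W), i ;; p = idm W /\ p ;; i = e.
Proof.
move=> /(congr1 (fun f : Hom Z Z => homM f)) ee.
set E := homM e; have {}ee : E *m E = E := ee.
have [r [A [B [AB BA]]]] := idempotent_factor ee.
have BE : B *m E = B by rewrite -AB mulmxA BA mul1mx.
have EA : E *m A = A by rewrite -AB -mulmxA BA mulmx1.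
have rE g : g \in G -> urep Z g *m E = E *m urep Z g.
  exact: homM_intertwines.
have pE g : g \in G -> hproj Z g *m E = E *m hproj Z g.
  exact: hom_hproj.
have BA_E (P Q : 'M_(rdegree (urep Z))) : P *m E = E *m P ->
    (B *m P *m A) *m (B *m Q *m A) = B *m (P *m Q) *m A.
  move=> PE; rewrite -!(mulmxA B) -(mulmxA P) -!mulmxA (mulmxA A) AB.
  by rewrite (mulmxA P) PE !mulmxA BE.
have repr : mx_repr G (fun g => B *m urep Z g *m A).
  split=> [|g h Gg Gh]; first by rewrite repr_mx1 mulmx1 BA.
  by rewrite repr_mxM // BA_E // rE.
pose X : rep := Representation (MxRepresentation repr).
have gr : grading X (fun g => B *m hproj Z g *m A).
  split=> [g h Gg Gh||g h Gg Gh].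
  - rewrite BA_E ?pE // hproj_orth //.
    by case: eqP => _; rewrite ?mulr0n ?mulmx0 ?mul0mx.
  - by rewrite -mulmx_suml -mulmx_sumr hproj_sum mulmx1.
  - by rewrite /= !BA_E ?pE ?rE // hproj_conj.
have [i Hi] : exists i : Hom (yd_object gr) Z, homM i = B.
  apply: hom_of_hproj => g Gg; rewrite ?hproj_yd_object //=.
    by rewrite -!mulmxA AB rE // !mulmxA BE.
  by rewrite -!mulmxA AB pE // !mulmxA BE.
have [p Hp] : exists p : Hom Z (yd_object gr), homM p = A.
  apply: hom_of_hproj => g Gg; rewrite ?hproj_yd_object //=.
    by rewrite !mulmxA AB -rE // -!mulmxA EA.
  by rewrite !mulmxA AB -pE // -!mulmxA EA.
exists (yd_object gr), i, p; split; apply: homM_inj.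
  by change (homM i *m homM p = 1%:M); rewrite Hi Hp.
by change (homM p *m homM i = E); rewrite Hi Hp.
Qed.

Definition conj_class := {c : {set gT} | c \in classes G}.

Lemma decomposition_classes Z :
  exists2 P : conj_class -> center (Rep k G),
    forall c, supported (val c) (P c) & is_direct_sum P Z.
Proof.
have split_class (c : conj_class) :
    exists t : {W : center (Rep k G) & (Hom W Z * Hom Z W)%type},
      (tagged t).1 ;; (tagged t).2 = idm (tag t) /\
      homM ((tagged t).2 ;; (tagged t).1) = class_proj Z (val c).
  have [e He] := class_proj_hom Z (valP c).
  have ee : e ;; e = e.
    apply: homM_inj; change (homM e *m homM e = homM e).
    by rewrite He class_proj_orth ?(valP c) // eqxx.
  have [W [i [p [ip pi]]]] := split_idem ee.
  exists (Tagged (fun W : center (Rep k G) => (Hom W Z * Hom Z W)%type) (i, p)).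
  by split; [exact: ip | rewrite -He -pi].
have [t Ht] := choice split_class.
pose i c := homM (tagged (t c)).1; pose p c := homM (tagged (t c)).2.
have ip c : i c *m p c = 1%:M.
  by have [/(congr1 (fun f : Hom (tag (t c)) (tag (t c)) => homM f)) e _] := Ht c.
have pi c : p c *m i c = class_proj Z (val c) by have [_ e] := Ht c.
have iE c : i c *m class_proj Z (val c) = i c by rewrite -pi mulmxA ip mul1mx.
have Ep c : class_proj Z (val c) *m p c = p c by rewrite -pi -mulmxA ip mulmx1.
exists (fun c => tag (t c)) => [c|].
  rewrite /supported -[LHS]mulmx1 -ip mulmxA hom_class_proj ?(valP c) //.
  by rewrite -/(i c) iE.
exists (fun c => (tagged (t c)).1), (fun c => (tagged (t c)).2).
split=> [c|c d cd|]; first by have [] := Ht c.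
  apply: homM_inj; rewrite homM0; change (i c *m p d = 0).
  rewrite -iE -Ep mulmxA -(mulmxA (i c)) (class_proj_orth _ (valP c) (valP d)).
  by rewrite (inj_eq val_inj) (negPf cd) mulr0n mulmx0 mul0mx.
apply: homM_inj; rewrite homM_sum; change (\sum_c p c *m i c = 1%:M).
rewrite (eq_bigr _ (fun c _ => pi c)) -(class_proj_sum Z).
by rewrite [RHS]big_sub.
Qed.

(** * A nonzero object supported on a given class *)

Section ClassObject.
Variable x0 : gT.
Hypothesis Gx0 : x0 \in G.

(** The grading of the regular representation k[G] where the basis vector e_a
    has degree x0 ^ a. *)
Definition class_object_proj g : 'M[k]_#|G| :=
  diag_mx (\row_i (x0 ^ enum_val i == g)%g%:R).

Lemma class_object_grading : grading regrep class_object_proj.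
Proof.
split=> [g h Gg Gh||g h Gg Gh].
- apply/matrixP=> i j; rewrite mul_diag_mx !mxE mulmxnE !mxE.
  case: (i =P j) => [->|_]; last by rewrite !mulr0n mulr0 mul0rn.
  rewrite !mulr1n -natrM mulnb -mulrnA mulnb; congr (nat_of_bool _)%:R.
  by case: eqP => //= ->.
- apply/matrixP=> i j; rewrite summxE.
  under eq_bigr => g Gg do rewrite !mxE.
  rewrite (bigD1 (x0 ^ enum_val i)%g) /= ?groupJ ?enum_valP // eqxx mxE.
  rewrite big1 ?addr0 // => g /andP[_ /negPf gx].
  by rewrite eq_sym gx mul0rn.
- apply/matrixP=> i j; rewrite mul_diag_mx mul_mx_diag !mxE eqxx /=.
  case: eqP => [->|_]; last by rewrite mul0r mulr0.
  rewrite mul1r mulr1 gring_indexK ?groupM ?enum_valP // conjgM.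
  by rewrite (inj_eq (conjg_inj h)).
Qed.

(** A nonzero object supported on the class of x0. *)
Definition class_object : center (Rep k G) := yd_object class_object_grading.

Lemma supported_class_object : supported (x0 ^: G)%g class_object.
Proof.
rewrite /supported -(gr_sum class_object_grading) /class_proj.
rewrite (eq_bigr class_object_proj) => [|g cg]; last first.
  have Gg := classes_sub (mem_classes Gx0) cg.
  exact: (hproj_yd_object class_object_grading Gg).
symmetry; rewrite (bigID (mem (x0 ^: G)%g)) /= [X in _ + X]big1 ?addr0.
  apply: eq_bigl => g.
  case: (boolP (g \in x0 ^: G)%g) => [cg|_]; rewrite ?andbF //.
  by rewrite (classes_sub (mem_classes Gx0) cg).
move=> g /andP[Gg /negP ncg]; apply/matrixP=> i j; rewrite !mxE.
case: eqP => [E|_]; last by rewrite mul0rn.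
by case: ncg; rewrite -E memJ_class ?enum_valP.
Qed.

Lemma class_object_nonzero : ~ is_zero class_object.
Proof.
move/is_zeroP/matrixP/(_ (ix 1) (ix 1)); rewrite !mxE eqxx => /eqP.
by rewrite oner_eq0.
Qed.

End ClassObject.

(** * Morphisms from k[G] ⊗ Z *)

(** The components of degree in the same conjugacy class are isomorphic as
    vector spaces. *)
Lemma supported_hproj_neq0 c Z g :
  c \in classes G -> supported c Z -> ~ is_zero Z -> g \in c -> hproj Z g != 0.
Proof.
move=> Cc Zc nZ cg; apply/eqP => Zg; apply/nZ/is_zeroP; rewrite -Zc.
apply: big1 => h ch.
have [x Gx Ex] : exists2 x, x \in G & h = (g ^ x)%g.
  case/imsetP: Cc ch cg => y Gy -> /class_eqP ch /class_eqP cg.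
  by apply/imsetP; rewrite -[imset _ _]/(g ^: G)%g cg -ch class_refl.
have Gg := classes_sub Cc cg.
have := hproj_conj Z Gg Gx; rewrite Zg mul0mx -Ex => E.
rewrite -[LHS]mul1mx -(repr_mx1 (urep Z)) -(mulVg x) repr_mxM ?groupV //.
by rewrite -mulmxA E mulmx0.
Qed.

Section Averaging.
Variables Z Z' : center (Rep k G).
Variables (phi : 'M[k]_(rdegree (urep Z), rdegree (urep Z'))).

(** The matrix of e_a ⊗ z |-> phi(z·a^-1)·a, from k[G] ⊗ Z to Z'. *)
Definition transport : 'M[k]_(#|G| * rdegree (urep Z), rdegree (urep Z')) :=
  \matrix_(x, l)
    let: (a, j) := enum_val (cast_ord (esym (mxvec_cast _ _)) x) in
    (urep Z (enum_val a)^-1%g *m phi *m urep Z' (enum_val a)) j l.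

Lemma transportE a j l : transport (mxvec_index a j) l =
  (urep Z (enum_val a)^-1%g *m phi *m urep Z' (enum_val a)) j l.
Proof. by rewrite mxE /mxvec_index cast_ordK enum_rankK. Qed.

Lemma transport_intertwines h : h \in G ->
  tprod (regrep h) (urep Z h) *m transport = transport *m urep Z' h.
Proof.
move=> Gh; apply/matrixP=> x l; case/mxvec_indexP: x => a j.
have -> : (transport *m urep Z' h) (mxvec_index a j) l
   = (urep Z (enum_val a)^-1%g *m phi *m urep Z' (enum_val a) *m urep Z' h) j l.
  by rewrite mxE [RHS]mxE; apply: eq_bigr => u _; rewrite transportE.
rewrite mxE sum_mxvec (bigD1 (gring_index G (enum_val a * h)%g)) //=.
rewrite [X in _ + X]big1 ?addr0 => [|b /negPf ba]; last first.
  by apply: big1 => u _; rewrite tprod_entry !mxE eqxx ba !mul0r.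
have regE : regrep h a (gring_index G (enum_val a * h)%g) = 1.
  by rewrite /= !mxE !eqxx.
under eq_bigr => u _ do rewrite tprod_entry regE mul1r transportE
  gring_indexK ?groupM ?enum_valP //.
set a' := enum_val a; have Ga : a' \in G by exact: enum_valP.
transitivity
  ((urep Z h *m (urep Z (a' * h)^-1%g *m phi *m urep Z' (a' * h)%g)) j l).
  by rewrite [RHS]mxE.
rewrite !mulmxA -(repr_mxM (urep Z)) ?groupV ?groupM // invMg mulKVg.
by rewrite (repr_mxM (urep Z')) // !mulmxA.
Qed.

End Averaging.

Lemma transport_hom c Z Z' : c \in classes G ->
  supported c Z -> supported c Z' -> ~ is_zero Z -> ~ is_zero Z' ->
  exists f : Hom (center_br br (regrep : Rep k G) ⊗ Z) Z', f <> 0.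
Proof.
move=> Cc Zc Z'c nZ nZ'.
have [g cg] : exists g, g \in c.
  by case/imsetP: Cc => x _ ->; exists x; apply: class_refl.
have Gg := classes_sub Cc cg.
have Zg := supported_hproj_neq0 Cc Zc nZ cg.
have Z'g := supported_hproj_neq0 Cc Z'c nZ' cg.
have [P HP] := sandwich_neq0 Zg Z'g.
(* phi preserves degrees, and is concentrated in degree g. *)
have [phi phiP phi0] : exists2 phi : 'M[k]_(rdegree (urep Z), rdegree (urep Z')),
    forall h, h \in G -> hproj Z h *m phi = phi *m hproj Z' h & phi != 0.
  exists (hproj Z g *m P *m hproj Z' g) => // h Gh.
  rewrite !mulmxA hproj_orth // -[RHS]mulmxA hproj_orth // eq_sym.
  by case: eqP => [->//|_]; rewrite !mulr0n mulmx0 !mul0mx.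
have [f Hf] : exists f : Hom (center_br br (regrep : Rep k G) ⊗ Z) Z',
    homM f = transport phi.
  apply: hom_of_hproj => [h|h Gh]; first exact: transport_intertwines.
  rewrite hproj_tens_onel //; last exact: supported_one_flip.
  apply/matrixP=> x l; case/mxvec_indexP: x => a j.
  rewrite mul_tprod1M.
  have -> : (transport phi *m hproj Z' h) (mxvec_index a j) l
     = (urep Z (enum_val a)^-1%g *m phi *m urep Z' (enum_val a)
          *m hproj Z' h) j l.
    by rewrite mxE [RHS]mxE; apply: eq_bigr => u _; rewrite transportE.
  under eq_bigr do rewrite transportE.
  set b := enum_val a; have Gb : b \in G by exact: enum_valP.
  transitivity ((hproj Z h *m (urep Z b^-1%g *m phi *m urep Z' b)) j l).
    by rewrite [RHS]mxE.
  congr (fun_of_matrix _ j l).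
  rewrite !mulmxA -(hproj_conj Z Gh) ?groupV // -(mulmxA _ (hproj _ _) phi).
  rewrite phiP ?groupJ ?groupV // mulmxA -(mulmxA _ (hproj _ _) (urep _ _)).
  by rewrite -hproj_conj ?groupJ ?groupV // conjgKV mulmxA.
(* The restriction of the morphism to e_1 ⊗ Z is phi. *)
exists f => /(congr1 (fun h : Hom _ _ => homM h)); rewrite Hf homM0 => T0.
case/negP: phi0; apply/eqP/matrixP=> j l.
move/matrixP/(_ (mxvec_index (ix 1) j) l): T0.
rewrite transportE gring_indexK //.
by rewrite invg1 !repr_mx1 mulmx1 mul1mx !mxE.
Qed.

(** * The module subcategories indexed by conjugacy classes *)

Fact supported_act c (Cc : c \in classes G) (X : tilde br)
    (Z : center_modcat br) : supported c Z -> supported c (act X Z).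
Proof.
by apply: supported_tens => //; apply: tilde_supported_one (proj2_sig X).
Qed.

(** The objects of the center supported on the class c. *)
Definition class_subcat (c : conj_class) : module_subcat (center_modcat br) :=
  @ModuleSubcat k (tilde br) (center_modcat br) (supported (val c))
    (supported_subquotient (valP c)) (@supported_act _ (valP c)).

Lemma decomposes_class_subcat : decomposes class_subcat.
Proof.
split=> [Z|c d cd Z Z' Zc Z'd f]; first exact: decomposition_classes.
apply: (supported_hom0 f (valP c) (valP d) _ Zc Z'd).
by rewrite (inj_eq val_inj).
Qed.

Lemma indecomposable_class_subcat c : indecomposable (submodcat (class_subcat c)).
Proof.
apply: indecomposable_of_homs => [|N P Nc Pc nN nP].
  have [c0 Gc0 Ec] := imsetP (valP c).
  exists (class_object Gc0); last exact: class_object_nonzero.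
  by rewrite /= Ec; apply: supported_class_object.
have [f nf] := transport_hom (valP c) Nc Pc nN nP.
by exists (exist _ _ (@tilde_mem_br regrep)), f.
Qed.

End CenterOfRep.

Theorem theorem7p6 (k : fieldType) (gT : finGroupType) (G : {group gT}) :
  exists D : {c : {set gT} | c \in classes G} ->
             module_subcat (center_modcat (Rep_braiding k G)),
    decomposes D /\ forall c, indecomposable (submodcat (D c)).
Proof.
exists (@class_subcat k gT G); split; first exact: decomposes_class_subcat.
exact: indecomposable_class_subcat.
Qed.
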